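(* Let $\mu$ be a doubling measure on $\mathbb{R}^2$ whose support is dense in $\mathbb{R}^2$. If $(\mathbb{R}^2,|\cdot|,\mu)$ supports a $p$-Poincaré inequality for some $p\ge1$, then $\mu$ is absolutely continuous with respect to Lebesgue measure $m_2$.
   Context: A Borel measure $\mu$ on a metric space $(X,\rho)$ is doubling if there is $\kappa\ge1$ with $0<\mu(B(x,2r))\le\kappa\,\mu(B(x,r))<\infty$ for all $x$, $r>0$. A Borel $g:X\to[0,\infty]$ is an upper gradient of a Borel $u:X\to\mathbb{R}$ if $|u(\gamma(b))-u(\gamma(a))|\le\int_a^b g(\gamma(t))\,dt$ for every rectifiable curve $\gamma:[a,b]\to X$ parametrized by arc length. $(X,\rho,\mu)$ supports a $p$-Poincaré inequality if there are $\Lambda\ge1$, $C>0$ such that for all balls $B$, all $u\in L^1_{loc}(X,\mu)$ and all upper gradients $g$ of $u$: $\frac1{\mu(B)}\int_B|u-u_B|\,d\mu\le C\,\mathrm{diam}(B)\big(\frac1{\mu(\Lambda B)}\int_{\Lambda B}g^p\,d\mu\big)^{1/p}$, where $u_B$ is the $\mu$-mean of $u$ over $B$. *)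

(* Defs.v *)
From HB Require Import structures.
From mathcomp Require Import all_boot all_order all_algebra.
From mathcomp Require Import all_classical all_reals all_analysis.
From mathcomp Require Import measurable_realfun.
Set Implicit Arguments. Unset Strict Implicit. Unset Printing Implicit Defensive.
Import Order.TTheory GRing.Theory Num.Theory.
Import numFieldNormedType.Exports.
Local Open Scope classical_set_scope.
Local Open Scope ring_scope.

Section Defs.
Context {R : realType}.

Definition dist2 (x y : R * R) : R :=
  Num.sqrt ((x.1 - y.1) ^+ 2 + (x.2 - y.2) ^+ 2).

Definition ball2 (x : R * R) (r : R) : set (R * R) := [set y | dist2 x y < r].

Definition curve_length (gam : R -> R * R) (s t : R) : \bar R :=
  ereal_sup [set v : \bar R | exists (n : nat) (ts : nat -> R),
     [/\ ts 0%N = s, ts n = t, (forall i, (i < n)%N -> ts i <= ts i.+1) &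
         v = (\sum_(i < n) dist2 (gam (ts i)) (gam (ts i.+1)))%:E]].

Definition arclength_param (gam : R -> R * R) (a b : R) : Prop :=
  a <= b /\ forall s t, a <= s -> s <= t -> t <= b ->
    curve_length gam s t = (t - s)%:E.

Definition upper_gradient (u : R * R -> R) (g : R * R -> \bar R) : Prop :=
  measurable_fun [set: R * R] g /\ (forall x, (0 <= g x)%E) /\
  forall (gam : R -> R * R) (a b : R), arclength_param gam a b ->
    ((`|u (gam b) - u (gam a)|)%:E <=
      \int[lebesgue_measure]_(t in `[a, b]%classic) g (gam t))%E.

Definition doubling (mu : {measure set (R * R)%type -> \bar R}) : Prop :=
  exists kappa : R, 1 <= kappa /\ forall (x : R * R) (r : R), 0 < r ->
    (0 < mu (ball2 x (2 * r)))%E /\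
    (mu (ball2 x (2 * r)) <= kappa%:E * mu (ball2 x r))%E /\
    (kappa%:E * mu (ball2 x r) < +oo)%E.

Definition msupport (mu : {measure set (R * R)%type -> \bar R}) : set (R * R) :=
  [set x | forall r : R, 0 < r -> (0 < mu (ball2 x r))%E].

Definition dense2 (S : set (R * R)) : Prop :=
  forall (x : R * R) (r : R), 0 < r -> ball2 x r `&` S !=set0.

Definition loc_integrable (mu : {measure set (R * R)%type -> \bar R})
  (u : R * R -> R) : Prop :=
  measurable_fun [set: R * R] u /\
  forall (x : R * R) (r : R), 0 < r -> mu.-integrable (ball2 x r) (EFin \o u).

Definition mmean (mu : {measure set (R * R)%type -> \bar R}) (A : set (R * R))
  (u : R * R -> R) : R :=
  fine (\int[mu]_(y in A) (u y)%:E) / fine (mu A).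

(* (R^2, |.|, mu) supports a p-Poincare inequality; the diameter of the
   Euclidean ball B(x, r) (r > 0) is 2 r. *)
Definition poincare (mu : {measure set (R * R)%type -> \bar R}) (p : R) : Prop :=
  exists (Lam C : R), 1 <= Lam /\ 0 < C /\
  forall (x : R * R) (r : R), 0 < r ->
  forall (u : R * R -> R) (g : R * R -> \bar R),
    loc_integrable mu u -> upper_gradient u g ->
    ((fine (mu (ball2 x r)))^-1%:E *
       \int[mu]_(y in ball2 x r) (`|u y - mmean mu (ball2 x r) u|)%:E <=
     (C * (2 * r))%:E *
       poweR ((fine (mu (ball2 x (Lam * r))))^-1%:E *
              \int[mu]_(y in ball2 x (Lam * r)) poweR (g y) p) p^-1)%E.

End Defs.

Definition lebesgue2 {R : realType} : set (R * R)%type -> \bar R :=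
  (@lebesgue_measure R \x @lebesgue_measure R)%E.

(* Main.v *)
(* A Lebesgue null compact set K in the plane meets few squares of a fine mesh.  In the partial order
   given by the cone of directions of slope at most 1, chains are 1-Lipschitz graphs over the first
   coordinate and antichains are 1-Lipschitz graphs over the second one; splitting n points into about
   2 sqrt n chains and antichains covers K by thin strips around such graphs of arbitrarily small
   total width (Alberti, Csornyei and Preiss).  If mu K > 0, some compact part of positive measure is
   covered by strips of a single type, say graphs over x.  Collapsing these strips yields 1-Lipschitz
   functions w, uniformly close to y, which near K depend on x only, with slope D.  Choosing w with
   nearly minimal L^2 norm of D makes the slopes Cauchy, so at a small ball around a point of K one
   has D close to a constant c in the mean, for w arbitrarily close to y.  Then w - c x has an upper
   gradient with small mean, although it is close to the linear function y - c x, whose oscillation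
   on the ball is comparable to the radius: this contradicts the Poincare inequality. *)

Require Import Defs.
From HB Require Import structures.
From mathcomp Require Import all_boot all_order all_algebra.
From mathcomp Require Import all_classical all_reals all_analysis.
From mathcomp Require Import measurable_realfun.
From mathcomp Require Import lra ring.
Set Implicit Arguments. Unset Strict Implicit. Unset Printing Implicit Defensive.
Import Order.TTheory GRing.Theory Num.Theory.
Import numFieldNormedType.Exports.
Local Open Scope classical_set_scope.
Local Open Scope ring_scope.

(** * Euclidean balls against the product topology and the product sigma-algebra *)

Section Plane.
Context {R : realType}.
Implicit Types (p q : R * R) (r s : R).

(** Two scales pull against each other. The ball must be small compared with the Lipschitz constant
    of the slope [D], so that [D] is nearly constant on it; [w] must be close to y relative to that
    ball; and the Lipschitz bound [2 / s] of the slope degrades as [w] approaches y. The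
    near-minimal pair breaks this circle: [D] is fixed, the radius [r] is read off from its
    Lipschitz constant, and only then is a closer pair [w1], [D1] taken, whose slope may be rough
    but is L^2-close to [D] on [K]. Away from [K] only the global Lipschitz bound is available. Its
    contribution is small because a neighbourhood of a compact set carries little more mass than the
    set. No density point is used: a ball of the prescribed radius is found by averaging over a net
    of [K]. Since the upper gradient is bounded by 4, its p-th power is at most a constant times
    itself, so every p >= 1 reduces to an L^1 estimate. *)

Lemma dist2_ge0 p q : 0 <= dist2 p q.
Proof. exact: sqrtr_ge0. Qed.

Lemma dist2C p q : dist2 p q = dist2 q p.
Proof. by rewrite /dist2 -sqrrN opprB -[(p.2 - _) ^+ 2]sqrrN opprB. Qed.

Lemma dist2xx p : dist2 p p = 0.
Proof. by rewrite /dist2 !subrr expr0n /= addr0 sqrtr0. Qed.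

Lemma dist2_sqr p q : dist2 p q ^+ 2 = (p.1 - q.1) ^+ 2 + (p.2 - q.2) ^+ 2.
Proof. by rewrite /dist2 sqr_sqrtr // addr_ge0 // sqr_ge0. Qed.

Lemma dist2_fst p q : `|p.1 - q.1| <= dist2 p q.
Proof.
rewrite -(ler_pXn2r (n := 2)) ?nnegrE ?dist2_ge0 //.
by rewrite dist2_sqr real_normK ?num_real// lerDl sqr_ge0.
Qed.

Lemma dist2_snd p q : `|p.2 - q.2| <= dist2 p q.
Proof.
rewrite -(ler_pXn2r (n := 2)) ?nnegrE ?dist2_ge0 //.
by rewrite dist2_sqr real_normK ?num_real// lerDr sqr_ge0.
Qed.

Lemma dist2_le p q : dist2 p q <= `|p.1 - q.1| + `|p.2 - q.2|.
Proof.
rewrite -(ler_pXn2r (n := 2)) ?nnegrE ?dist2_ge0 ?addr_ge0 //.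
rewrite dist2_sqr [leRHS]sqrrD !real_normK ?num_real//.
by have := mulr_ge0 (normr_ge0 (p.1 - q.1)) (normr_ge0 (p.2 - q.2)); lra.
Qed.

Lemma dist2_triangle q p (s : R * R) : dist2 p s <= dist2 p q + dist2 q s.
Proof.
have h0 := dist2_ge0 p q; have h1 := dist2_ge0 q s.
rewrite -(ler_pXn2r (n := 2)) ?nnegrE ?dist2_ge0 ?addr_ge0 //.
rewrite [leRHS]sqrrD !dist2_sqr.
set a := p.1 - q.1; set b := p.2 - q.2.
set c := q.1 - s.1; set d := q.2 - s.2.
have -> : p.1 - s.1 = a + c by rewrite /a /c; lra.
have -> : p.2 - s.2 = b + d by rewrite /b /d; lra.
suff : a * c + b * d <= dist2 p q * dist2 q s by lra.
apply: le_trans (ler_norm _) _.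
rewrite -(ler_pXn2r (n := 2)) ?nnegrE ?mulr_ge0 //.
rewrite real_normK ?num_real// exprMn !dist2_sqr -/a -/b -/c -/d.
have := sqr_ge0 (a * d - b * c); lra.
Qed.

Lemma dist2_lt_fst p q r : dist2 p q < r -> `|p.1 - q.1| < r.
Proof. exact: le_lt_trans (dist2_fst _ _). Qed.

Lemma dist2_lt_snd p q r : dist2 p q < r -> `|p.2 - q.2| < r.
Proof. exact: le_lt_trans (dist2_snd _ _). Qed.

Lemma ball2_sub p q r s : dist2 p q + s <= r -> ball2 q s `<=` ball2 p r.
Proof. by move=> h z zs; apply: le_lt_trans (dist2_triangle q _ _) _; rewrite /ball2/= in zs *; lra. Qed.

Lemma ball_ball2 p r : 0 < r -> ball p (r / 2) `<=` ball2 p r.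
Proof.
move=> r0 q [/= h1 h2]; apply: le_lt_trans (dist2_le _ _) _.
by rewrite /ball/= in h1 h2; lra.
Qed.

Lemma ball2_ball p r : ball2 p r `<=` ball p r.
Proof. by move=> q h; split; [exact: dist2_lt_fst|exact: dist2_lt_snd]. Qed.

(** Open sets of the product topology are tested on squares, whereas the balls of the theorem are
    Euclidean; the two are nested up to a factor 2. *)
Lemma open_ball2P (U : set (R * R)) :
  open U <-> forall p, U p -> exists2 r : R, 0 < r & ball2 p r `<=` U.
Proof.
rewrite openE; split=> [oU p /oU /nbhs_ballP[r /= r0 h]|h p /h [r r0 hr]].
  by exists r => //; apply: subset_trans h; exact: ball2_ball.
apply/nbhs_ballP; exists (r / 2) => /=; first by rewrite divr_gt0.
by move=> q [h1 h2]; apply: hr; apply: (ball_ball2 r0); split.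
Qed.

Lemma ball2_open p r : open (ball2 p r).
Proof.
apply/open_ball2P => q pq; exists (r - dist2 p q); first by rewrite subr_gt0.
by apply: ball2_sub; rewrite addrC subrK.
Qed.

Lemma ball2_center p r : 0 < r -> ball2 p r p.
Proof. by rewrite /ball2/= dist2xx. Qed.

Lemma rat_ball (x e : R) : 0 < e -> exists c : rat, ball (ratr c : R) e x.
Proof.
move=> e0; have /rat_in_itvoo[c] : x - e < x + e by lra.
rewrite in_itv/= => /andP[h1 h2]; exists c.
by rewrite /ball/= ltr_norml; apply/andP; split; lra.
Qed.

(** The sigma-algebra is the product one, so an open set is exhibited as a countable union of
    squares with rational centres. *)
Lemma open_measurable2 (U : set (R * R)) : open U -> measurable U.
Proof.
move=> /open_ball2P oU.
pose F (t : rat * rat * nat) : set (R * R) :=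
  let B := ball (ratr t.1.1 : R) t.2.+1%:R^-1 `*` ball (ratr t.1.2 : R) t.2.+1%:R^-1 in
  if pselect (B `<=` U) then B else set0.
suff -> : U = \bigcup_t F t.
  apply: countable_bigcupT_measurable => [|t]; first exact: countableP.
  rewrite /F; case: pselect => h /=; last exact: measurable0.
  by apply: measurableX; apply: measurable_ball.
apply/seteqP; split => [p Up|p [t _]]; last by rewrite /F; case: pselect => // h /h.
have [r r0 rU] := oU _ Up.
(* Two points of a square of half-side 1/(n+1) differ by less than 2/(n+1) in each coordinate, hence
   are at distance less than 4/(n+1) < r. *)
have [n nr] : exists n : nat, n.+1%:R^-1 < r / 4.
  have r40 : 0 < r / 4 by rewrite divr_gt0.
  have [n _ /(_ n (leqnn n)) h] := near_infty_natSinv_lt (PosNum r40).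
  by exists n.
have n0 : 0 < n.+1%:R^-1 :> R by rewrite invr_gt0.
have app (x : R) : exists c : rat, ball (ratr c : R) n.+1%:R^-1 x := rat_ball x n0.
have [c hc] := app p.1; have [d hd] := app p.2.
exists (c, d, n) => //=; rewrite /F/=; case: pselect => //= hn.
case: hn => q [/= q1 q2]; apply: rU; apply: le_lt_trans (dist2_le _ _) _.
rewrite /ball/= in hc hd q1 q2.
move: nr hc hd q1 q2; set e := n.+1%:R^-1 => nr hc hd q1 q2.
have := ler_distD (ratr c) p.1 q.1; have := ler_distD (ratr d) p.2 q.2.
rewrite [`|p.2 - ratr d|]distrC [`|p.1 - ratr c|]distrC; lra.
Qed.

Lemma ball2_measurable p r : measurable (ball2 p r).
Proof. by apply: open_measurable2; exact: ball2_open. Qed.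

Lemma closed_measurable2 (F : set (R * R)) : closed F -> measurable F.
Proof.
move=> cF; rewrite -(setCK F); apply: measurableC; apply: open_measurable2.
exact: closed_openC.
Qed.

Definition lip (L : R) (f : R * R -> R) := forall p q, `|f p - f q| <= L * dist2 p q.

Lemma lip_measurable L f : lip L f -> measurable_fun [set: R * R] f.
Proof.
move=> lf.
apply: (measurability _ (RGenOInfty.measurableE R)) => // _ [_ [x ->] <-].
rewrite setTI; apply: open_measurable2; apply/open_ball2P => p /=.
rewrite in_itv/= andbT => xp.
have L0 : 0 < `|L| + 1 by rewrite ltr_pwDr.
exists ((f p - x) / (`|L| + 1)); first by rewrite divr_gt0 // subr_gt0.
move=> q; rewrite /ball2/= in_itv/= andbT ltr_pdivlMr // => h.
have h1 := lf p q.
have h2 : L * dist2 p q <= dist2 p q * (`|L| + 1).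
  by have := ler_wpM2r (dist2_ge0 p q) (ler_norm L); have := dist2_ge0 p q; lra.
have := ler_norm (f p - f q); lra.
Qed.

Lemma hausdorff2 : hausdorff_space (R * R)%type.
Proof. exact: norm_hausdorff. Qed.

End Plane.

(** * Continuity along monotone sequences, and regularity by closed and open sets *)

Section Regularity.
Context {R : realType}.
Variable mu : {measure set (R * R)%type -> \bar R}.
Implicit Types (F G A D : set (R * R)).
Local Open Scope ereal_scope.

Lemma nonincreasing_measure_lt (F : (set (R * R))^nat) (e : \bar R) :
  (forall n, measurable (F n)) -> mu (F 0%N) < +oo ->
  (forall n, F n.+1 `<=` F n) -> mu (\bigcap_n F n) < e -> exists n, mu (F n) < e.
Proof.
move=> mF F0 dF; apply: contraPP => /forallNP h; apply/negP; rewrite -leNgt.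
have cv : (mu \o F) x @[x --> \oo] --> mu (\bigcap_n F n).
  apply: nonincreasing_cvg_mu => //; first exact: bigcapT_measurable.
  by apply/nonincreasing_seqP => n; apply/subsetPset; exact: dF.
rewrite -(cvg_lim (@ereal_hausdorff R) cv).
apply: lime_ge; first by apply/cvg_ex; eexists; exact: cv.
by apply: nearW => n; rewrite leNgt; apply/negP/h.
Qed.

Lemma nondecreasing_measure_gt (F : (set (R * R))^nat) (e : \bar R) :
  (forall n, measurable (F n)) ->
  (forall n, F n `<=` F n.+1) -> e < mu (\bigcup_n F n) -> exists n, e < mu (F n).
Proof.
move=> mF dF; apply: contraPP => /forallNP h; apply/negP; rewrite -leNgt.
have cv : (mu \o F) x @[x --> \oo] --> mu (\bigcup_n F n).
  apply: nondecreasing_cvg_mu => //; first exact: bigcupT_measurable.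
  by apply/nondecreasing_seqP => n; apply/subsetPset; exact: dF.
rewrite -(cvg_lim (@ereal_hausdorff R) cv).
apply: lime_le; first by apply/cvg_ex; eexists; exact: cv.
by apply: nearW => n; rewrite leNgt; apply/negP/h.
Qed.

(** Approximation from both sides makes the class stable under complements. The error is measured in
    a window [D] because [mu] need not be finite on the plane. *)
Definition closed_open_approx D A := measurable A /\
  forall e : R, (0 < e)%R -> exists F G, [/\ closed F, open G, F `<=` A, A `<=` G &
    mu ((G `\` F) `&` D) < e%:E].

Variable D : set (R * R).
Hypotheses (mD : measurable D) (Dfin : mu D < +oo).

(** The points at depth at least 1/(n+1) in [A] form closed sets exhausting it, and [G] can be [A]
    itself. *)
Lemma open_approx A : open A -> closed_open_approx D A.
Proof.
move=> oA; split; first exact: open_measurable2.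
move=> e e0.
pose F (n : nat) := [set p : R * R | ball2 p (n.+1%:R^-1) `<=` A].
have cF n : closed (F n).
  rewrite -(setCK (F n)); apply: open_closedC; apply/open_ball2P => p /=.
  move=> /existsNP[q /not_implyP[pq Aq]].
  have : ball2 q n.+1%:R^-1 p by rewrite /ball2/= dist2C.
  move=> /((open_ball2P (ball2 q n.+1%:R^-1)).1 (@ball2_open _ q _))[r r0 hr].
  exists r => // z /hr zq h; apply: Aq; apply: h.
  by rewrite /ball2/= dist2C.
have sF n : F n `<=` F n.+1.
  move=> p h q pq; apply: h; apply: lt_trans pq _.
  by rewrite ltf_pV2 ?posrE // ltr_nat.
have FA n : F n `<=` A by move=> p; apply; apply: ball2_center.
have mF n : measurable ((A `\` F n) `&` D).
  apply: measurableI => //; apply: measurableD; first exact: open_measurable2.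
  exact: closed_measurable2.
have [||||n hn] := @nonincreasing_measure_lt (fun n => (A `\` F n) `&` D) e%:E.
- exact: mF.
- apply: le_lt_trans Dfin; apply: le_measure; rewrite ?inE //.
- by move=> n p [[Ap nF] Dp]; split => //; split => // /sF.
- suff -> : \bigcap_n ((A `\` F n) `&` D) = set0 by rewrite measure0 lte_fin.
  apply/seteqP; split => // p h.
  have [[Ap _] _] := h 0%N I.
  have [r r0 rA] := proj1 (open_ball2P _) oA _ Ap.
  have [n _ /(_ n (leqnn n)) hn] := near_infty_natSinv_lt (PosNum r0).
  have [[_ nF] _] := h n I; apply: nF => q pq; apply: rA.
  exact: lt_trans pq hn.
by exists (F n), A; split.
Qed.

Lemma approx_setC A : closed_open_approx D A -> closed_open_approx D (~` A).
Proof.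
move=> [mA h]; split; first exact: measurableC.
move=> e /h[F [G [cF oG FA AG m]]]; exists (~` G), (~` F); split.
- exact: open_closedC.
- exact: closed_openC.
- exact: subsetC.
- exact: subsetC.
- by rewrite [~` F `\` _]setDE setCK [~` F `&` _]setIC -setDE.
Qed.

(** An infinite union of closed sets need not be closed, so a finite union is kept, taken long
    enough by continuity from above in the window of finite measure. *)
Lemma approx_bigcup (A : (set (R * R))^nat) :
  (forall n, closed_open_approx D (A n)) -> closed_open_approx D (\bigcup_n A n).
Proof.
move=> h; split; first by apply: bigcupT_measurable => n; case: (h n).
move=> e e0.
(* These errors add up to [e / 2], which leaves room for the strict inequality. *)
have e20 n : (0 < e / (2 ^ n.+2)%:R)%R by rewrite divr_gt0 // ltr0n expn_gt0.
have {h} h n := (h n).2 _ (e20 n).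
have /choice[F' hF] := h; have /choice[G hG] := hF.
have cF n : closed (F' n) by case: (hG n).
have oG n : open (G n) by case: (hG n).
have FA n : F' n `<=` A n by case: (hG n).
have AG n : A n `<=` G n by case: (hG n).
have mG n : mu ((G n `\` F' n) `&` D) < (e / (2 ^ n.+2)%:R)%:E by case: (hG n).
pose U := \bigcup_n G n.
have oU : open U by apply: bigcup_open => n _.
pose F n := \big[setU/set0]_(i < n.+1) F' i.
have FE n p : F n p <-> exists2 i, (i < n.+1)%N & F' i p.
  by rewrite /F -(bigcup_mkord n.+1 F').
have cFn n : closed (F n) by apply: closed_bigsetU.
have mfin n : measurable ((G n `\` F' n) `&` D).
  apply: measurableI => //; apply: measurableD; first exact: open_measurable2.
  exact: closed_measurable2.
have mF n : measurable ((U `\` F n) `&` D).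
  apply: measurableI => //; apply: measurableD; first exact: open_measurable2.
  exact: closed_measurable2.
have [||||n hn] := @nonincreasing_measure_lt (fun n => (U `\` F n) `&` D) e%:E.
- by [].
- by apply: le_lt_trans Dfin; apply: le_measure; rewrite ?inE //; apply: subIsetr.
- move=> n p [[Up nF] Dp]; split => //; split => //.
  by move=> /FE[i ni Fi]; apply: nF; apply/FE; exists i => //; exact: ltnW.
- apply: le_lt_trans (_ : mu (\bigcup_n ((G n `\` F' n) `&` D)) < _).
    apply: le_measure; rewrite ?inE //.
    + exact: bigcapT_measurable.
    + exact: bigcupT_measurable.
    + move=> p hp; have [[[n _ Gn] _] Dp] := hp 0%N I.
      exists n => //; split => //; split => // Fn.
      have [[_ nF] _] := hp n I; apply: nF; apply/FE.
      by exists n.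
  have := measure_sigma_subadditive mu mfin (bigcupT_measurable _ mfin) (@subset_refl _ _).
  move=> /le_lt_trans; apply.
  apply: (@le_lt_trans _ _ (\sum_(0 <= n <oo) (e / 2 / (2 ^ n.+1)%:R)%:E)).
    apply: lee_nneseries => // n _.
    apply: le_trans (ltW (mG n)) _; rewrite lee_fin.
    by rewrite -mulrA -invfM -natrM -expnS.
  apply: le_lt_trans (epsilon_trick0 _ _) _ => //.
    by rewrite divr_ge0 // ltW.
  by rewrite lte_fin ltr_pdivrMr // ltr_pMr // ltr1n.
exists (F n), U; split => //.
  by move=> p /FE[i _ /FA ?]; exists i.
by move=> p [i _ /AG ?]; exists i.
Qed.

(** The approximable sets form a sigma-algebra containing the open sets. The product sigma-algebra
    is generated by preimages under the coordinates, and these, being 1-Lipschitz, pull open rays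
    back to open sets. *)
Lemma measurable_approx A : measurable A -> closed_open_approx D A.
Proof.
have sa : sigma_algebra setT (closed_open_approx D).
  split.
  - by apply: open_approx; exact: open0.
  - by move=> B; rewrite setTD; exact: approx_setC.
  - exact: approx_bigcup.
have key (f : R * R -> R) (lf : lip 1 f) (B : set R) : measurable B -> closed_open_approx D (f @^-1` B).
  move=> mB; have : (RGenOInfty.G (R := R)).-sigma.-measurable B.
    by rewrite -RGenOInfty.measurableE.
  move: B {mB}.
  suff : <<s RGenOInfty.G (R := R) >> `<=` [set B | closed_open_approx D (f @^-1` B)] by [].
  apply: smallest_sub.
    split => /=.
    - by rewrite preimage_set0; case: sa.
    - by move=> C; rewrite setTD preimage_setC; exact: approx_setC.
    - by move=> C hC; rewrite preimage_bigcup; exact: approx_bigcup.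
  move=> _ [x ->] /=; apply: open_approx; apply/open_ball2P => p /=.
  rewrite in_itv/= andbT => xp.
  exists (f p - x)%R; first by rewrite subr_gt0.
  move=> q; rewrite /ball2/= in_itv/= andbT => h.
  have := lf p q; rewrite mul1r => h1.
  by have := ler_norm (f p - f q)%R; lra.
apply: smallest_sub => //.
by move=> B [] [C mC <-]; rewrite setTI; apply: key => //;
  move=> p q; rewrite mul1r; [exact: dist2_fst|exact: dist2_snd].
Qed.

End Regularity.

(** * Separated nets, neighbourhoods of compact sets, inner regularity *)

Section Compactness.
Context {R : realType}.

Lemma compact_ball2 (K : set (R * R)) r : closed K -> K `<=` ball2 0 r -> compact K.
Proof.
move=> cK Kr; have cI : compact (`[- r, r] : set R) by exact: segment_compact.
apply: (subclosed_compact cK (compact_setX cI cI)) => p /Kr; rewrite /ball2/= dist2C => h.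
have := dist2_lt_fst h; have := dist2_lt_snd h; rewrite !subr0 !ltr_norml !in_itv/=.
by move=> /andP[? ?] /andP[? ?]; split; apply/andP; split; exact: ltW.
Qed.

Lemma compact_cover2 (K : set (R * R)) : compact K -> cover_compact K.
Proof.
pose T : ptopologicalType :=
  HB.pack (R * R)%type (Topological.class (R * R)%type) (Pointed.class (R * R)%type).
by have /(congr1 (fun P => P K)) /= -> := @compact_cover T.
Qed.

Lemma compact_bounded2 (K : set (R * R)) : compact K -> exists2 r : R, 0 < r & K `<=` ball2 0 r.
Proof.
move=> /compact_cover2 /(_ nat setT (fun n => ball2 0 n.+1%:R)).
case=> [n _|p _|s _ hs]; first exact: ball2_open.
  have [n hn] : exists n : nat, dist2 0 p < n%:R.
    by exists (Num.bound (dist2 0 p)); apply: le_lt_trans (archi_boundP _) => //; exact: dist2_ge0.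
  by exists n => //; apply: lt_trans hn _; rewrite ltr_nat.
exists (\sum_(i <- finmap.enum_fset s) i.+1%:R + 1); first by rewrite ltr_wpDl // sumr_ge0.
move=> p /hs[i /= si hp]; apply: lt_le_trans hp _.
rewrite (big_rem i) //= -addrA lerDl addr_ge0 // sumr_ge0 //.
Qed.

Lemma compact_net (K : set (R * R)) (r : R) : compact K -> 0 < r ->
  exists s : seq (R * R), (forall p, p \in s -> K p) /\
    (forall p, K p -> exists2 q, q \in s & dist2 q p < r).
Proof.
move=> + r0; move=> /compact_cover2 /(_ (R * R)%type K (fun p => ball2 p r)).
case=> [p _|p Kp|s sK hs]; first exact: ball2_open.
  by exists p => //; exact: ball2_center.
exists (finmap.enum_fset s); split => [p ps|p /hs[q sq qp]]; first by have := sK p ps; rewrite inE.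
by exists q.
Qed.

Fixpoint dist_separated (r : R) (s : seq (R * R)) : Prop :=
  if s is p :: s' then (forall q, q \in s' -> r <= dist2 p q) /\ dist_separated r s' else True.

Lemma separated_subseq r (s : seq (R * R)) : 0 < r -> exists s', [/\ dist_separated r s', {subset s' <= s} &
  forall p, p \in s -> exists2 q, q \in s' & dist2 q p < r].
Proof.
move=> r0; elim: s => [|p s [s' [ss s's hs]]]; first by exists [::].
have [h|] := pselect (exists2 q, q \in s' & dist2 q p < r).
  exists s'; split => // [q /s's|q]; rewrite inE; first by move=> ->; rewrite orbT.
  by move=> /orP[/eqP ->|/hs].
move=> h; exists (p :: s'); split => /=.
- split => // q qs; rewrite leNgt; apply/negP => pq; apply: h.
  by exists q => //; rewrite dist2C.
- by move=> q; rewrite !inE => /orP[->//|/s's ->]; rewrite orbT.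
- move=> q; rewrite inE => /orP[/eqP ->|/hs[z zs zq]].
    by exists p; rewrite ?mem_head ?dist2xx.
  by exists z => //; rewrite inE zs orbT.
Qed.

(** The radius [2 * r] is a net of mesh [r] followed by a greedy thinning that moves each point by
    less than [r]. *)
Lemma separated_net (K : set (R * R)) (r : R) : compact K -> 0 < r ->
  exists s : seq (R * R), [/\ dist_separated r s, (forall p, p \in s -> K p) &
    (forall p, K p -> exists2 q, q \in s & dist2 q p < 2 * r)].
Proof.
move=> cK r0; have [s [sK Ks]] := compact_net cK r0.
have [s' [ss s's hs]] := separated_subseq s r0.
exists s'; split => // [p /s's/sK//|p /Ks[q /hs[z zs zq] qp]].
by exists z => //; apply: le_lt_trans (dist2_triangle q _ _) _; lra.
Qed.

Definition nbhd2 (K : set (R * R)) (s : R) : set (R * R) := \bigcup_(p in K) ball2 p s.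

Lemma nbhd2_open K s : open (nbhd2 K s).
Proof. by apply: bigcup_open => p _; exact: ball2_open. Qed.

Lemma nbhd2_measurable K s : measurable (nbhd2 K s).
Proof. by apply: open_measurable2; exact: nbhd2_open. Qed.

Lemma sub_nbhd2 K s : 0 < s -> K `<=` nbhd2 K s.
Proof. by move=> s0 p Kp; exists p => //; exact: ball2_center. Qed.

Lemma nbhd2_le K s t : s <= t -> nbhd2 K s `<=` nbhd2 K t.
Proof. by move=> st p [q Kq h]; exists q => //; exact: lt_le_trans h st. Qed.

(** The neighbourhoods of radius 1/(n+1) decrease to [K] because [K] is closed, and they have finite
    measure because it is bounded. *)
Lemma measure_nbhd2 (mu : {measure set (R * R)%type -> \bar R}) (K : set (R * R)) (e : \bar R) :
  compact K -> (forall p r, (mu (ball2 p r) < +oo)%E) -> (mu K < e)%E ->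
  exists2 s : R, 0 < s & (mu (nbhd2 K s) < e)%E.
Proof.
move=> cK fin Ke; have [r r0 Kr] := compact_bounded2 cK.
have clK : closed K by exact: compact_closed hausdorff2 cK.
pose F n := nbhd2 K n.+1%:R^-1.
have mF n : measurable (F n) by exact: nbhd2_measurable.
have [|n||n hn] := @nonincreasing_measure_lt R mu F e mF.
- apply: le_lt_trans (fin 0 (r + 1)); apply: le_measure; rewrite ?inE.
  + exact: nbhd2_measurable.
  + exact: ball2_measurable.
  + move=> p [q /Kr Kq]; rewrite invr1 /ball2/= => h.
    by apply: le_lt_trans (dist2_triangle q _ _) _; rewrite /ball2/= in Kq; lra.
- by apply: nbhd2_le; rewrite lef_pV2 ?posrE // ler_nat.
- suff -> : \bigcap_n nbhd2 K n.+1%:R^-1 = K by [].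
  apply/seteqP; split => [p hp|p Kp n _]; last by apply: sub_nbhd2.
  apply: contrapT => nKp; have oK := closed_openC clK.
  have [s s0 hs] := (open_ball2P (~` K)).1 oK p nKp.
  have [n _ /(_ n (leqnn n)) hn] := near_infty_natSinv_lt (PosNum s0).
  have [q Kq qp] := hp n I; apply: (hs q) => //.
  by rewrite /ball2/= dist2C; exact: lt_trans qp hn.
by exists n.+1%:R^-1.
Qed.

Lemma measurable_ball2_gt0 (mu : {measure set (R * R)%type -> \bar R}) (A : set (R * R)) :
  measurable A -> (0 < mu A)%E -> exists2 r : R, 0 < r & (0 < mu (A `&` ball2 0%R r))%E.
Proof.
move=> mA A0; pose F n := A `&` ball2 (0 : R * R) n.+1%:R.
have mF n : measurable (F n) by apply: measurableI => //; exact: ball2_measurable.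
have [n||n hn] := @nondecreasing_measure_gt R mu F 0%E mF.
- by move=> p [Ap hp]; split => //; rewrite /ball2/= in hp *; apply: (lt_trans hp); rewrite ltr_nat.
- suff -> : \bigcup_n (A `&` ball2 0 n.+1%:R) = A by [].
  apply/seteqP; split => [p [n _ []]//|p Ap].
  exists (Num.bound (dist2 0 p)) => //; split => //.
  rewrite /ball2/=; apply: lt_trans (archi_boundP (dist2_ge0 _ _)) _.
  by rewrite ltr_nat.
by exists n.+1%:R.
Qed.

(** A bounded part of [A] has positive finite measure; a closed subset approximating it with an
    error below that measure cannot be null. *)
Lemma compact_inner (mu : {measure set (R * R)%type -> \bar R}) (A : set (R * R)) :
  (forall p r, (mu (ball2 p r) < +oo)%E) ->
  measurable A -> (0 < mu A)%E -> exists K, [/\ compact K, K `<=` A & (0 < mu K)%E].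
Proof.
move=> fin mA A0; have [r r0 hr] := measurable_ball2_gt0 mA A0.
have mB := ball2_measurable (0 : R * R) r.
have mAB : measurable (A `&` ball2 0 r) by exact: measurableI.
have finA : mu (A `&` ball2 0%R r) \is a fin_num.
  rewrite ge0_fin_numE ?measure_ge0 //; apply: le_lt_trans (fin 0 r).
  by apply: le_measure; rewrite ?inE //; exact: subIsetr.
have [_ /(_ (fine (mu (A `&` ball2 0%R r))))[|F [G [cF oG FA AG FG]]]] := measurable_approx mB (fin 0 r) mAB.
  by rewrite fine_gt0 // hr ltey_eq finA.
exists F; split; first by apply: (@compact_ball2 F r) => // p /FA[].
- by move=> p /FA[].
- have mF := closed_measurable2 cF.
  have : (mu (A `&` ball2 0%R r) <= mu ((G `\` F) `&` ball2 0%R r) + mu F)%E.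
    have mGF : measurable ((G `\` F) `&` ball2 0 r).
      by apply: measurableI => //; apply: measurableD => //; exact: open_measurable2.
    apply: (@le_trans _ _ (mu (((G `\` F) `&` ball2 0%R r) `|` F))); last exact: measureU2.
    apply: le_measure; rewrite ?inE //; first exact: measurableU.
    move=> p Ap; have [Fp|nFp] := pselect (F p); [by right|left].
    by split; [split => //; exact: AG|case: Ap].
  rewrite fineK // in FG; move=> h; rewrite lt0e measure_ge0 andbT; apply/eqP => F0.
  by rewrite F0 adde0 in h; have := le_lt_trans h FG; rewrite ltxx.
Qed.

End Compactness.

(** * Covering a finite strict order by few chains and antichains *)

Section ChainsAntichains.
Local Open Scope nat_scope.
Context {T : eqType} (lt : rel T).
Hypotheses (lt_trans : transitive lt) (lt_irr : irreflexive lt).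

Definition antichain (a : seq T) := {in a &, forall p q, ~~ lt p q}.

(** Mirsky's argument: the minimal elements are an antichain, and a chain among the other elements
    can be prolonged downwards by one. *)
Lemma long_chain_or_antichains k (s : seq T) :
  (exists c, [/\ size c = k.+1, {subset c <= s} & sorted lt c]) \/
  (exists L : seq (seq T), [/\ size L = k, {in L, forall a, antichain a} & {subset s <= flatten L}]).
Proof.
elim: k s => [|k IH] s.
  case: s => [|x s]; [right|left].
    by exists [::]; split.
  by exists [:: x]; split=> // y; rewrite inE => /eqP ->; rewrite mem_head.
have [[c [sc cs lc]]|[L [sL aL cL]]] := IH [seq x <- s | has (lt^~ x) s].
  left; case: c sc cs lc => // x c [sc] cs lc.
  have := cs x (mem_head _ _); rewrite mem_filter => /andP[/hasP[y ys yx] xs].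
  exists [:: y, x & c]; split; first by rewrite /= sc.
    move=> z; rewrite inE => /orP[/eqP ->//|/cs]; rewrite mem_filter => /andP[_ //].
  by rewrite /= yx.
right; exists ([seq x <- s | ~~ has (lt^~ x) s] :: L); split; first by rewrite /= sL.
  move=> a; rewrite inE => /orP[/eqP ->|/aL //].
  move=> p q; rewrite !mem_filter => /andP[_ ps] /andP[/hasPn hq qs].
  exact: hq.
move=> x xs; rewrite /= mem_cat mem_filter xs andbT.
case: (boolP (has _ _)) => //= hx; apply: cL.
by rewrite mem_filter hx.
Qed.

(** Chains of [k.+1] elements are removed greedily. Each removal uses up at least [k] elements, so
    there are at most [n]; when no such chain is left, [k] antichains finish. *)
Lemma chains_antichains_cover k n (s : seq T) : uniq s -> size s <= n * k ->
  exists C A : seq (seq T), [/\ size C <= n, size A <= k, {in C, forall c, sorted lt c},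
    {in A, forall a, antichain a} & {subset s <= flatten C ++ flatten A}].
Proof.
elim: n s => [|n IH] s us.
  rewrite mul0n leqn0 => /nilP ->; exists [::], [::]; split=> //.
move=> hs; have [[c [sc cs lc]]|[L [sL aL cL]]] := long_chain_or_antichains k s; last first.
  by exists [::], L; split => //; rewrite sL.
have uc : uniq c by exact: (sorted_uniq lt_trans lt_irr).
have us' : uniq [seq x <- s | x \notin c] by exact: filter_uniq.
have hs' : size [seq x <- s | x \notin c] <= n * k.
  have : size c <= size [seq x <- s | x \in c].
    by apply: uniq_leq_size => // x xc; rewrite mem_filter xc cs.
  move: hs; rewrite -(count_predC (mem c) s) !size_filter sc => hs h1.
  by rewrite mulSn in hs; rewrite -(leq_add2l k); apply: leq_trans hs; rewrite leq_add2r (ltnW h1).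
have [C [A [sC sA lC aA h]]] := IH _ us' hs'.
exists (c :: C), A; split => //.
  by move=> d; rewrite inE => /orP[/eqP ->|/lC].
move=> x xs; rewrite /= -catA mem_cat; case: (boolP (x \in c)) => //= xc.
by apply: h; rewrite mem_filter xc.
Qed.

End ChainsAntichains.

(** * Covering a null compact set by thin strips around Lipschitz graphs *)

Section Strips.
Context {R : realType}.

Definition lip1d (f : R -> R) := forall x y, `|f x - f y| <= `|x - y|.

Definition strip (f : R -> R) (d : R) : set (R * R) := [set p | `|p.2 - f p.1| < d].

Fixpoint graphs (l : seq ((R -> R) * R)) : Prop :=
  if l is fd :: l' then [/\ lip1d fd.1, 0 < fd.2 & graphs l'] else True.

Fixpoint strips (l : seq ((R -> R) * R)) : set (R * R) :=
  if l is fd :: l' then strip fd.1 fd.2 `|` strips l' else set0.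

(** The second component is the half-thickness of a strip, so this is half of the total vertical
    thickness. *)
Definition width (l : seq ((R -> R) * R)) := \sum_(fd <- l) fd.2.

Lemma dist_max (a b c d e : R) : `|a - c| <= e -> `|b - d| <= e ->
  `|Num.max a b - Num.max c d| <= e.
Proof.
rewrite !ler_norml => /andP[h1 h2] /andP[h3 h4].
by case: (lerP a b) => ?; case: (lerP c d) => ?; apply/andP; split; lra.
Qed.

Lemma dist_min (a b c d e : R) : `|a - c| <= e -> `|b - d| <= e ->
  `|Num.min a b - Num.min c d| <= e.
Proof.
rewrite !ler_norml => /andP[h1 h2] /andP[h3 h4].
by case: (lerP a b) => ?; case: (lerP c d) => ?; apply/andP; split; lra.
Qed.

(** One point is added at a time: [f] is clamped between the two cones of slope 1 with apex [p].
    Clamping keeps the Lipschitz bound, and the compatibility of the data keeps the earlier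
    values. *)
Lemma lip1d_through (s : seq (R * R)) :
  (forall p q, p \in s -> q \in s -> `|p.2 - q.2| <= `|p.1 - q.1|) ->
  exists2 f, lip1d f & forall p, p \in s -> f p.1 = p.2.
Proof.
elim: s => [|p s IH] h.
  by exists (fun _ => 0) => // x y; rewrite subrr normr0.
have [|f lf fs] := IH.
  by move=> u v us vs; apply: h; rewrite inE ?us ?vs orbT.
pose up x := p.2 + `|x - p.1|; pose lo x := p.2 - `|x - p.1|.
exists (fun x => Num.max (Num.min (f x) (up x)) (lo x)).
  move=> x y; have h1 := lf x y; have h2 := ler_distD y x p.1.
  have h3 := ler_distD x y p.1; rewrite [`|y - x|]distrC in h3.
  apply: dist_max; last by rewrite /lo ler_norml; apply/andP; split; lra.
  by apply: dist_min => //; rewrite /up ler_norml; apply/andP; split; lra.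
move=> q; rewrite inE => /orP[/eqP ->|qs].
  rewrite /up /lo subrr normr0 subr0 addr0.
  by rewrite max_r // ge_min lexx orbT.
have := h q p; rewrite !inE qs eqxx orbT => /(_ isT isT); rewrite ler_norml => /andP[h1 h2].
by rewrite fs // /up /lo min_l ?max_l //; lra.
Qed.

Definition cone_lt (p q : R * R) := (p.1 < q.1) && (`|q.2 - p.2| <= q.1 - p.1).

Lemma cone_lt_trans : transitive cone_lt.
Proof.
move=> q p r /andP[h1 h2] /andP[h3 h4]; apply/andP; split; first exact: lt_trans h3.
by have := ler_distD q.2 r.2 p.2; lra.
Qed.

Lemma cone_lt_irr : irreflexive cone_lt.
Proof. by move=> p; rewrite /cone_lt ltxx. Qed.

Lemma sorted_cone (c : seq (R * R)) p q : sorted cone_lt c -> p \in c -> q \in c ->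
  `|p.2 - q.2| <= `|p.1 - q.1|.
Proof.
elim: c => // x c IH /=; rewrite (path_sortedE cone_lt_trans) => /andP[/allP xc sc].
rewrite !inE => /orP[/eqP ->|pc] /orP[/eqP ->|qc].
- by rewrite !subrr.
- have /andP[_ h] := xc q qc; rewrite distrC [leRHS]distrC.
  exact: le_trans h (ler_norm _).
- have /andP[_ h] := xc p pc; exact: le_trans h (ler_norm _).
- exact: IH.
Qed.

Lemma antichain_cone (a : seq (R * R)) p q : antichain cone_lt a -> p \in a -> q \in a ->
  `|p.1 - q.1| <= `|p.2 - q.2|.
Proof.
move=> ha pa qa; have := ha p q pa qa; have := ha q p qa pa.
rewrite /cone_lt !negb_and -!leNgt -!ltNge [`|q.2 - _|]distrC.
by rewrite ler_norml => /orP[h1|h1] /orP[h2|h2]; apply/andP; have := normr_ge0 (p.2 - q.2); split; lra.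
Qed.

Lemma strips_cat l l' : strips (l ++ l') = strips l `|` strips l'.
Proof. by elim: l => [|a l IH] /=; rewrite ?set0U // IH setUA. Qed.

Lemma width_cat l l' : width (l ++ l') = width l + width l'.
Proof. by rewrite /width big_cat. Qed.

Lemma graphs_cat l l' : graphs l -> graphs l' -> graphs (l ++ l').
Proof. by elim: l => //= a l IH [h1 h2 /IH h3] /h3. Qed.

Lemma width_ge0 l : graphs l -> 0 <= width l.
Proof.
rewrite /width; elim: l => [_|a l IH [_ a0 /IH]]; first by rewrite big_nil.
by rewrite big_cons; lra.
Qed.

Lemma strip_open f d : lip1d f -> open (strip f d).
Proof.
move=> lf; apply/open_ball2P => p; rewrite /strip/= => pd.
exists ((d - `|p.2 - f p.1|) / 2); first by lra.
move=> q; rewrite /ball2/= => h.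
have := le_lt_trans (dist2_fst _ _) h; have := le_lt_trans (dist2_snd _ _) h.
have := lf p.1 q.1; have := ler_distD p.2 q.2 (f q.1); have := ler_distD (f p.1) p.2 (f q.1).
by rewrite [`|q.2 - p.2|]distrC; lra.
Qed.

Lemma strips_open l : graphs l -> open (strips l).
Proof.
elim: l => [_|a l IH [h1 h2 /IH h3]] /=; first exact: open0.
by apply: openU => //; exact: strip_open.
Qed.

Lemma chains_strips (C : seq (seq (R * R))) (d : R) : 0 < d ->
  (forall c, c \in C -> forall p q, p \in c -> q \in c -> `|p.2 - q.2| <= `|p.1 - q.1|) ->
  exists l, [/\ graphs l, width l = (size C)%:R * (2 * d) &
    forall p q, p \in flatten C -> `|p.1 - q.1| < d -> `|p.2 - q.2| < d -> strips l q].
Proof.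
move=> d0; elim: C => [|c C IH] h.
  by exists [::]; split => //; rewrite /width big_nil mul0r.
have [|l [gl wl hl]] := IH; first by move=> b bC; apply: h; rewrite inE bC orbT.
have [f lf fc] := lip1d_through (h c (mem_head _ _)).
exists ((f, 2 * d) :: l); split => /=.
- by split => //; lra.
- by rewrite /width big_cons -/(width l) wl /= -natr1; lra.
move=> p q; rewrite mem_cat => /orP[pc|pC] h1 h2; [left|right; exact: hl pC h1 h2].
rewrite /strip/=; have := lf p.1 q.1; rewrite fc // => h3.
by have := ler_distD p.2 q.2 (f q.1); rewrite [`|q.2 - p.2|]distrC; lra.
Qed.

Lemma separated_uniq (r : R) (s : seq (R * R)) : 0 < r -> dist_separated r s -> uniq s.
Proof.
move=> r0; elim: s => //= p s IH [h /IH ->]; rewrite andbT; apply/negP => /h.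
by rewrite dist2xx; lra.
Qed.

(** Stated for a superadditive set function, so as to serve both for a measure and for [A] sent to
    the integral of a nonnegative function over [A]. *)
Lemma separated_sum (m : set (R * R) -> \bar R) (r : R) (s : seq (R * R)) :
  (0 <= m set0)%E ->
  (forall A B, measurable A -> measurable B -> A `&` B = set0 -> m A + m B <= m (A `|` B))%E ->
  dist_separated r s ->
  (\sum_(z <- s) m (ball2 z (r / 2)) <= m (\big[setU/set0]_(z <- s) ball2 z (r / 2)))%E.
Proof.
move=> m0 mU; elim: s => [|p s IH /= [h /IH hs]]; first by rewrite !big_nil.
rewrite !big_cons; apply: le_trans (mU _ _ _ _ _).
- exact: leeD2l.
- exact: ball2_measurable.
- by apply: bigsetU_measurable => z _; exact: ball2_measurable.
- apply/seteqP; split => // q [qp]; rewrite -bigcup_seq => -[z /= zs qz].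
  have := h z zs; have := dist2_triangle q p z.
  by move: qp qz; rewrite /ball2/= [dist2 z q]dist2C; lra.
Qed.

Definition swap (p : R * R) : R * R := (p.2, p.1).

(** Volume count: the balls of radius [d / 2] about a [d]-separated net are disjoint, have measure
    at least [(d / 2) ^+ 2], and lie in a neighbourhood of measure below [(t / 2) ^+ 2]. The net
    thus has at most [(t / d) ^+ 2] points, hence about [t / d] chains and as many antichains, each
    costing a strip of width [4 * d]. *)
Lemma null_compact_strips (nu : {measure set (R * R)%type -> \bar R}) (K : set (R * R)) (e : R) :
  (forall p r, (nu (ball2 p r) < +oo)%E) ->
  (forall p (r : R), 0 < r -> ((r ^+ 2)%:E <= nu (ball2 p r))%E) ->
  compact K -> nu K = 0%E -> 0 < e ->
  exists l l', [/\ graphs l, graphs l', width l <= e, width l' <= e &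
    forall p, K p -> strips l p \/ strips l' (swap p)].
Proof.
move=> fin nub cK K0 e0.
(* With [n * d <= t + d <= 2 * t], the total width is at most [4 * n * d <= 8 * t = e / 2]. *)
pose t := e / 16.
have t0 : 0 < t by rewrite /t; lra.
have [|s s0 hs] := @measure_nbhd2 _ nu K ((t / 2) ^+ 2)%:E cK fin.
  by rewrite K0 lte_fin exprn_gt0 // divr_gt0.
pose d := Num.min s t.
have d0 : 0 < d by rewrite lt_min s0 t0.
have [ds dt] : d <= s /\ d <= t by split; rewrite ge_min lexx ?orbT.
have [z [sz zK Kz]] := separated_net cK d0.
pose n := (Num.trunc (t / d)).+1.
have [n1 n2] : t <= n%:R * d /\ n%:R * d <= t + d.
  have /andP[h1 h2] := truncn_itv (divr_ge0 (ltW t0) (ltW d0)).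
  split; first by rewrite -ler_pdivrMr // ltW.
  by rewrite /n -natr1 mulrDl mul1r lerD2r -ler_pdivlMr.
have nz : (size z <= n * n)%N.
  have := @separated_sum nu d z; rewrite measure0 => /(_ (lexx _)) h.
  have {}h : (\sum_(p <- z) nu (ball2 p (d / 2)) <= nu (\big[setU/set0]_(p <- z) ball2 p (d / 2)))%E.
    by apply: h => // A B mA mB AB; rewrite measureU.
  have : ((size z)%:R * (d / 2) ^+ 2 <= (t / 2) ^+ 2).
    rewrite -lee_fin; apply: le_trans (ltW hs).
    apply: le_trans (_ : \sum_(p <- z) nu (ball2 p (d / 2)) <= _)%E.
      rewrite -sum1_size natr_sum mulr_suml -sumEFin.
      by apply: lee_sum => p _; rewrite mul1r; apply: nub; lra.
    apply: le_trans h _; apply: le_measure; rewrite ?inE.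
    - by apply: bigsetU_measurable => p _; exact: ball2_measurable.
    - exact: nbhd2_measurable.
    - move=> p; rewrite -bigcup_seq => -[q /= /zK Kq qp].
      by exists q => //; apply: lt_le_trans qp _; lra.
  move=> h1; rewrite -(ler_nat R) natrM -(ler_pM2r (exprn_gt0 2 d0)).
  have : t ^+ 2 <= (n%:R * d) ^+ 2 by rewrite ler_pXn2r ?nnegrE ?mulr_ge0 // ltW.
  by rewrite exprMn !expr2 in h1 *; nra.
have uz := separated_uniq d0 sz.
have [C [A [sC sA lC aA hz]]] := chains_antichains_cover cone_lt_trans cone_lt_irr uz nz.
have d20 : 0 < 2 * d by lra.
have [|l [gl wl hl]] := @chains_strips C _ d20.
  by move=> c cC p q; apply: sorted_cone; exact: lC.
have [|l' [gl' wl' hl']] := @chains_strips (map (map swap) A) _ d20.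
  move=> c /mapP[a aA' ->] p q /mapP[p' pa ->] /mapP[q' qa ->] /=.
  by apply: (antichain_cone (aA _ aA')).
have szle m : (m <= n)%N -> m%:R * (2 * (2 * d)) <= e.
  move=> mn; have : m%:R * d <= n%:R * d by rewrite ler_wpM2r ?ler_nat // ltW.
  by rewrite /t in n2 dt; lra.
exists l, l'; split => //.
- by rewrite wl; exact: szle.
- by rewrite wl' size_map; exact: szle.
move=> p /Kz[q qz qp]; have h1 := dist2_lt_fst qp; have h2 := dist2_lt_snd qp.
have := hz q qz; rewrite mem_cat => /orP[qC|qA]; [left|right].
  exact: hl qC h1 h2.
apply: (hl' (swap q)) => //; rewrite -map_flatten.
by apply/mapP; exists q.
Qed.

End Strips.

(** * Extracting a compact part covered by strips of one type at every width *)

Section ThinPart.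
Context {R : realType}.

Definition thin (tr : R * R -> R * R) (K : set (R * R)) := forall e : R, 0 < e ->
  exists l, [/\ graphs l, width l <= e & forall p, K p -> strips l (tr p)].

Definition isometric (tr : R * R -> R * R) := forall p q, dist2 (tr p) (tr q) = dist2 p q.

Lemma swap_isometric : isometric swap.
Proof. by move=> p q; rewrite /dist2 /= addrC. Qed.

Lemma preimage_isometric_open tr U : isometric tr -> open U -> open (tr @^-1` U).
Proof.
move=> ti /open_ball2P oU; apply/open_ball2P => p /oU[r r0 h]; exists r => // q pq.
by apply: h; rewrite /ball2/= ti.
Qed.

(** A tail of the strips, of total width at most [2 * 2^-1 ^+ m], still covers [K]; compactness cuts
    this open cover down to the finite list that [thin] asks for. *)
Lemma limsup_thin tr (l : nat -> seq ((R -> R) * R)) (K : set (R * R)) : isometric tr ->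
  (forall n, graphs (l n)) -> (forall n, width (l n) <= 2^-1 ^+ n) -> compact K ->
  (forall p, K p -> forall m, exists2 n, (m <= n)%N & strips (l n) (tr p)) ->
  thin tr K.
Proof.
move=> ti gl wl /compact_cover2 cK Kl e e0.
have [m hm] : exists m : nat, 2 * 2^-1 ^+ m <= e.
  have e20 : 0 < e / 2 by lra.
  have : (2^-1 ^+ n) @[n --> \oo] --> (0 : R).
    by apply: cvg_expr; rewrite ger0_norm ?invr_ge0 // invf_lt1 // ltr1n.
  move=> /cvgrPdist_lt/(_ _ e20)[m _ /(_ m (leqnn m))] /=.
  by rewrite sub0r normrN => /(le_lt_trans (ler_norm _)) h; exists m; lra.
have [n _|p Kp|F sF FK] := cK nat [set n | (m <= n)%N] (fun n => tr @^-1` strips (l n)).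
- by apply: preimage_isometric_open => //; exact: strips_open.
- by have [n mn pn] := Kl p Kp m; exists n.
(* Concatenation of [l m], ..., [l (m + k - 1)]. *)
pose fix L (m k : nat) := if k is k'.+1 then l m ++ L m.+1 k' else [::].
have gL j k : graphs (L j k) by elim: k j => //= k IH j; apply: graphs_cat.
have wL j k : width (L j k) <= 2 * 2^-1 ^+ j.
  elim: k j => [|k IH] j /=; first by rewrite /width big_nil mulr_ge0 // exprn_ge0 // invr_ge0.
  rewrite width_cat; have := IH j.+1; have := wl j; rewrite exprS.
  by set u := _ ^+ j; have : 2^-1 = 1 / 2 :> R; rewrite ?div1r // => ->; lra.
have sL j k n p : (j <= n < j + k)%N -> strips (l n) p -> strips (L j k) p.
  elim: k j => [|k IH] j; first by rewrite addn0 => /andP[h1 /(leq_ltn_trans h1)]; rewrite ltnn.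
  case/andP => jn nk pn; rewrite /= strips_cat.
  move: jn; rewrite leq_eqVlt => /orP[/eqP ->|jn]; [by left|right].
  by apply: IH => //; rewrite jn addSnnS.
exists (L m (\sum_(n <- finmap.enum_fset F) n.+1)%N); split => //; first exact: le_trans (wL _ _) hm.
move=> p /FK[n /= nF pn]; apply: (sL _ _ n) => //.
have := sF n nF; rewrite inE /= => -> /=.
by rewrite (big_rem n) //= addnCA ltn_addr.
Qed.

(** A point outside the upper limit of the strips of one type lies, from some index on, in the
    strips of the other type. So [K] is the union of two upper limits, one of which has positive
    measure. *)
Lemma compact_thin_part (mu nu : {measure set (R * R)%type -> \bar R}) (K : set (R * R)) :
  (forall p r, (mu (ball2 p r) < +oo)%E) ->
  (forall p r, (nu (ball2 p r) < +oo)%E) ->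
  (forall p (r : R), 0 < r -> ((r ^+ 2)%:E <= nu (ball2 p r))%E) ->
  compact K -> nu K = 0%E -> (0 < mu K)%E ->
  exists K' tr, [/\ compact K', (0 < mu K')%E, tr = id \/ tr = swap & thin tr K'].
Proof.
move=> fmu fnu nub cK K0 muK.
have e0 n : 0 < 2^-1 ^+ n :> R by rewrite exprn_gt0 // invr_gt0.
have /choice[l /choice[l' hl]] := fun n => null_compact_strips fnu nub cK K0 (e0 n).
pose A (tr : R * R -> R * R) (l : nat -> seq ((R -> R) * R)) :=
  \bigcap_m \bigcup_(n in [set n | (m <= n)%N]) (tr @^-1` strips (l n)).
have mA tr k : isometric tr -> (forall n, graphs (k n)) -> measurable (A tr k).
  move=> ti gk; apply: bigcapT_measurable => m; apply: bigcup_measurable => n _.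
  by apply: open_measurable2; apply: preimage_isometric_open => //; exact: strips_open.
have idi : isometric id by [].
have gl n : graphs (l n) by case: (hl n).
have gl' n : graphs (l' n) by case: (hl n).
have clK : closed K by exact: compact_closed hausdorff2 cK.
have mK := closed_measurable2 clK.
have select tr k : tr = id \/ tr = swap -> isometric tr -> (forall n, graphs (k n)) ->
    (forall n, width (k n) <= 2^-1 ^+ n) -> (0 < mu (K `&` A tr k))%E ->
    exists K' tr, [/\ compact K', (0 < mu K')%E, tr = id \/ tr = swap & thin tr K'].
  move=> htr ti gk wk /(compact_inner fmu (measurableI _ _ mK (mA tr k ti gk)))[K' [cK' K'A K'0]].
  exists K', tr; split => //; apply: (limsup_thin ti gk wk cK') => p /K'A[_ h] m.
  by have [n mn pn] := h m I; exists n.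
have [h|h] := leP (mu (K `&` A id l)) 0%E; last first.
  by apply: (select id l) => //; [left|move=> n; case: (hl n)].
apply: (select swap l') => //; [by right|exact: swap_isometric|by move=> n; case: (hl n)|].
apply: lt_le_trans muK _.
have -> : mu (K `&` A swap l') = (mu (K `&` A id l) + mu (K `&` A swap l'))%E.
  by have /eqP -> : mu (K `&` A id l) == 0%E; rewrite ?add0e // eq_le h measure_ge0.
apply: (@le_trans _ _ (mu ((K `&` A id l) `|` (K `&` A swap l')))).
  apply: le_measure; rewrite ?inE //.
    by apply: measurableU; apply: measurableI => //; apply: mA => //; exact: swap_isometric.
  move=> p Kp; have [Ap|/existsNP[m hm]] := pselect (A id l p); first by left.
  right; split => // m' _; exists (maxn m m'); first by rewrite /= leq_maxr.
  have [_ _ _ _ /(_ p Kp)[pl|//]] := hl (maxn m m').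
  by exfalso; apply: hm => _; exists (maxn m m') => //; rewrite /= leq_maxl.
apply: measureU2; apply: measurableI => //; apply: mA => //; exact: swap_isometric.
Qed.

End ThinPart.

(** * Collapsing the strips by a Lipschitz function close to the height *)

Section Collapse.
Context {R : realType}.

(** 1-Lipschitz for the maximum norm. Restricting such a function to a graph of slope at most 1
    gives a 1-Lipschitz function of x with no loss; a Euclidean bound would lose a factor at each
    strip. *)
Definition lip_sup (w : R * R -> R) := forall p q e,
  `|p.1 - q.1| <= e -> `|p.2 - q.2| <= e -> `|w p - w q| <= e.

Fixpoint flat (w : R * R -> R) (l : seq ((R -> R) * R)) : Prop :=
  if l is fd :: l' then
    (forall x y y', `|y - fd.1 x| <= 2 * fd.2 -> `|y' - fd.1 x| <= 2 * fd.2 -> w (x, y) = w (x, y'))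
    /\ flat w l'
  else True.

(** Strips already collapsed stay collapsed, since the new function sees y only through the value of
    the old one. *)
Lemma flat_congr (w w' : R * R -> R) l :
  (forall x y y', w (x, y) = w (x, y') -> w' (x, y) = w' (x, y')) -> flat w l -> flat w' l.
Proof.
by move=> h; elim: l => //= a l IH [h1 /IH h2]; split => // x y y' hy hy'; apply: h; exact: h1.
Qed.

(* In the induction, [min w (max phi (w - 4 d))] sends the strip of half-width [2 d] around the graph
   of [f] to [phi]; the margin over [d] leaves room for the smoothing. *)
Lemma collapse l : graphs l -> exists w, [/\ lip_sup w,
  (forall p, p.2 - 4 * width l <= w p <= p.2),
  (forall x y y', y <= y' -> w (x, y) <= w (x, y')) & flat w l].
Proof.
elim: l => [_|[f d] l IH [/= lf d0 gl]].
  exists snd; split => //.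

  by move=> p; rewrite /width big_nil mulr0 subr0 !lexx.
have [w [lw wb wm wf]] := IH gl.
pose phi x := w (x, f x - 2 * d).
pose w' p := Num.min (w p) (Num.max (phi p.1) (w p - 4 * d)).
exists w'; split.
- move=> p q e h1 h2; apply: dist_min; first exact: lw.
  apply: dist_max.
    apply: lw => //=; have -> : f p.1 - 2 * d - (f q.1 - 2 * d) = f p.1 - f q.1 by lra.
    exact: le_trans (lf _ _) h1.
  have -> : w p - 4 * d - (w q - 4 * d) = w p - w q by lra.
  exact: lw.
- move=> p; rewrite /width big_cons -/(width l) /=; have /andP[h1 h2] := wb p.
  rewrite /w'; apply/andP; split; last by rewrite ge_min h2.
  by rewrite le_min le_max; apply/andP; split; [|apply/orP; right]; lra.
- move=> x y y' yy; have := wm x _ _ yy; rewrite /w' /= => h.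
  by rewrite le_min !ge_min h /= ge_max !le_max lexx /= lerD2r h !orbT.
- split => /=; last by apply: flat_congr wf => x y y' h; rewrite /w' h.
  (* Monotonicity in y and the Lipschitz bound put [w] between [phi] and [phi + 4 * d] on the strip,
     where the truncation therefore returns [phi]. *)
  have key x y : `|y - f x| <= 2 * d -> w' (x, y) = phi x.
    rewrite ler_norml => /andP[h1 h2].
    have h3 : phi x <= w (x, y) by apply: wm; lra.
    have h4 : w (x, y) <= phi x + 4 * d.
      have h : `|w (x, y) - w (x, f x - 2 * d)| <= 4 * d.
        by apply: lw; rewrite /= ?subrr ?normr0 ?ler_norml; [|apply/andP; split]; lra.
      by have := le_trans (ler_norm _) h; rewrite /phi; lra.
    by rewrite /w' /= max_l ?min_r //; lra.
  by move=> x y y' h h'; rewrite !key.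
Qed.

(** Moving both coordinates by at most [d / 2] from a point of a strip changes the distance to the
    graph by at most [d], hence stays in the doubled strip. *)
Lemma flat_margin w l : graphs l -> flat w l -> exists2 r : R, 0 < r &
  forall p, strips l p -> forall x y y', `|x - p.1| <= r -> `|y - p.2| <= r -> `|y' - p.2| <= r ->
  w (x, y) = w (x, y').
Proof.
elim: l => [_ _|[f d] l IH [/= lf d0 gl] [wf wl]]; first by exists 1.
have [r r0 h] := IH gl wl; exists (Num.min (d / 2) r); first by rewrite lt_min r0 divr_gt0.
move=> p [pf|pl] x y y'; last first.
  by rewrite !le_min => /andP[_ h1] /andP[_ h2] /andP[_ h3]; apply: h pl _ _ _ h1 h2 h3.
rewrite /strip/= in pf; rewrite !le_min => /andP[h1 _] /andP[h2 _] /andP[h3 _].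
have aux z : `|z - p.2| <= d / 2 -> `|z - f x| <= 2 * d.
  move=> hz; have := ler_distD p.2 z (f x); have := ler_distD (f p.1) p.2 (f x).
  by have := lf p.1 x; rewrite [`|p.1 - x|]distrC; lra.
by apply: wf; exact: aux.
Qed.

End Collapse.

(** * Horizontal averaging *)

Section Smoothing.
Context {R : realType}.

Lemma mean_value (f df : R -> R) : (forall x, is_derive x (1 : R) f (df x)) ->
  forall a b, exists c, [/\ `|c - a| <= `|b - a|, (a <= b -> a <= c <= b) & f b - f a = df c * (b - a)].
Proof.
move=> hf.
have cf : continuous f by move=> x; apply: differentiable_continuous; apply/derivable1_diffP; have [] := hf x.
have key a b : a <= b -> exists2 c, a <= c <= b & f b - f a = df c * (b - a).
  move=> ab.
  have [c hc e] := MVT_segment ab (fun x _ => hf x) (continuous_subspaceT cf).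
  by exists c => //; move: hc; rewrite in_itv.
move=> a b; have [ab|ba] := leP a b.
  have [c hc e] := key _ _ ab; exists c; split => //; case/andP: hc => h1 h2.
  by rewrite !ger0_norm ?subr_ge0 //; lra.
have [c /andP[h1 h2] e] := key _ _ (ltW ba); exists c; split.
- by rewrite !ler0_norm ?subr_le0 //; lra.
- by move=> ab; lra.
- by lra.
Qed.

(** The fundamental theorem is applied to integrals from a base point to its right. The base point
    is moved left with [x], and normalizing at 0 makes the value independent of it. *)
Lemma antiderivative (f : R -> R) : continuous f -> exists F, forall x, is_derive x (1 : R) F (f x).
Proof.
move=> cf.
pose P a x := \int[lebesgue_measure]_(t in `[a, x]) f t.
have dP (a x : R) : a < x -> is_derive x (1 : R) (P a) (f x).
  move=> ax; have xu : x < x + 1 by lra.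
  have [|||d e] := @continuous_FTC1 R f (BLeft a) x (x + 1) xu.
  - apply: continuous_compact_integrable; first exact: segment_compact.
    exact: continuous_subspaceT.
  - exact: ax.
  - exact: cf.
  by move: d e; rewrite -/(P a) derive1E => d <-; exact: derivableP.
have Pab (a b x y : R) : a < x -> b < x -> a < y -> b < y -> P a x - P a y = P b x - P b y.
  wlog xy : x y / x <= y => [h|ax bx ay byy].
    move=> ax bx ay byy; have [xy|yx] := leP x y; first exact: h.
    by have := h y x (ltW yx) ay byy ax bx; lra.
  have dab z : x <= z -> is_derive z (1 : R) (P a \- P b) (0 : R).
    move=> xz; have := is_deriveB (dP a z (lt_le_trans ax xz)) (dP b z (lt_le_trans bx xz)).
    by rewrite subrr.
  have d1 z : z \in `]x, y[ -> is_derive z (1 : R) (P a \- P b) (0 : R).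
    by rewrite in_itv /= => /andP[/ltW xz _]; exact: dab.
  have d2 : {within `[x, y], continuous (P a \- P b)}.
    apply: derivable_within_continuous => z; rewrite in_itv /= => /andP[xz _].
    by have [] := dab z xz.
  have [c _] := MVT_segment xy d1 d2.
  by rewrite mul0r /=; lra.
pose F x := P (- `|x| - 2) x - P (- `|x| - 2) 0.
exists F => x.
pose a := - `|x| - 3.
have ax : a < x by have := ler_norm (- x); rewrite normrN /a; lra.
have FP : \forall y \near x, P a y - P a 0 = F y.
  near=> y; have yx : `|x - y| < 1 by near: y; apply: cvgr_dist_lt => //; exact: cvg_id.
  have := ler_norm (- y); have := normr_ge0 y; rewrite normrN.
  have := ler_distD x y 0; have := ler_distD y x 0; rewrite !subr0 [`|y - x|]distrC => *.
  by apply: Pab; rewrite /a; lra.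
have h : is_derive x (1 : R) (fun y => P a y - P a 0) (f x).
  by rewrite -[f x]subr0; apply: is_deriveB; exact: dP.
exact: near_eq_is_derive h.
Unshelve. all: by end_near. Qed.


Lemma lip_sup_row w y : lip_sup w -> continuous (fun x : R => w (x, y)).
Proof.
move=> lw x; apply/cvgrPdist_lt => e e0; near=> z.
have h : `|x - z| < e by near: z; apply: cvgr_dist_lt => //; exact: cvg_id.
apply: le_lt_trans h; apply: lw => //=; by rewrite subrr normr0.
Unshelve. all: by end_near. Qed.

(** [v] is the mean of [w] over the horizontal segment from [p] of length [s]. Its x-derivative is
    the difference quotient of [w], which is Lipschitz with constant [2 / s], whence the quadratic
    remainder. Averaging in x alone preserves independence of y. *)
Lemma smoothing (w : R * R -> R) (s : R) : lip_sup w -> 0 < s ->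
  exists v, [/\ lip_sup v, (forall p, `|v p - w p| <= s),
    (forall p x, `|v (x, p.2) - v p - (w (p.1 + s, p.2) - w p) / s * (x - p.1)|
        <= 2 / s * `|x - p.1| ^+ 2) &
    (forall x y y', (forall t, 0 <= t <= s -> w (x + t, y) = w (x + t, y')) -> v (x, y) = v (x, y'))].
Proof.
move=> lw s0.
have /choice[F hF] := fun y => antiderivative (lip_sup_row (y := y) lw).
pose v p := (F p.2 (p.1 + s) - F p.2 p.1) / s.
have dF x y t : is_derive (t : R) (1 : R) (fun t => F y (x + t)) (w (x + t, y)).
  have := is_derive1_comp (f := F y) (g := fun t => x + t) (x := t).
  have d1 : is_derive (t : R) (1 : R) (fun t => x + t) (1 : R).
    by rewrite -[X in is_derive _ _ _ X]add0r; apply: is_deriveD.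
  move=> /(_ _ _ (hF y (x + t)) d1).
  by rewrite mulr1.
(* The mean value theorem for a difference of two antiderivatives reduces a difference of averages
   to a difference of [w] at one common shift [t]. *)
have vdiff x y x' y' : exists2 t, 0 <= t <= s & v (x, y) - v (x', y') = w (x + t, y) - w (x' + t, y').
  have [c [_ hc e]] := mean_value (fun t => is_deriveB (dF x y t) (dF x' y' t)) 0 s.
  exists c; first exact/hc/ltW.
  have {}e : F y (x + s) - F y' (x' + s) - (F y (x + 0) - F y' (x' + 0)) =
    (w (x + c, y) - w (x' + c, y')) * (s - 0) by exact: e.
  move: e; rewrite !addr0 subr0 /v /= => e.
  by rewrite -mulrBl; apply: (canLR (mulfK _)); rewrite ?gt_eqF // -e; lra.
exists v; split.
- move=> [x y] [x' y'] e /= h1 h2; have [t _ ->] := vdiff x y x' y'.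
  by apply: lw => //=; have -> : x + t - (x' + t) = x - x' by lra.
- move=> [x y]; have [c [_ hc e]] := mean_value (dF x y) 0 s.
  have {hc}/andP[c0 cs] := hc (ltW s0).
  have -> : v (x, y) = w (x + c, y).
    rewrite /v /=; apply: (canLR (mulfK _)); rewrite ?gt_eqF //.
    by move: e; rewrite addr0 subr0.
  apply: lw => /=; last by rewrite subrr normr0 ltW.
  have -> : x + c - x = c by lra.
  by rewrite ger0_norm.
- move=> [x0 y] x /=.
  have dv z : is_derive (z : R) (1 : R) (fun z => v (z, y)) ((w (z + s, y) - w (z, y)) / s).
    have h1 : is_derive (z : R) (1 : R) (fun t => F y (t + s)) (w (z + s, y)).
      have := dF s y z; rewrite addrC; congr (is_derive _ _ _ _).
      by apply/funext => u; rewrite addrC.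
    have h2 := is_deriveB h1 (hF y z).
    have := is_deriveZ s^-1 h2.
    rewrite /GRing.scale /= [s^-1 * _]mulrC; congr (is_derive _ _ _ _).
    by apply/funext => u /=; rewrite /v /= mulrC.
  have [c [hc _ ->]] := mean_value dv x0 x.
  rewrite -mulrBl normrM expr2 mulrA ler_wpM2r // -mulrBl normrM [`|s^-1|]gtr0_norm ?invr_gt0 //.
  rewrite mulrAC ler_wpM2r ?invr_ge0 ?(ltW s0) //.
  have h1 : `|w (c + s, y) - w (x0 + s, y)| <= `|x - x0|.
    by apply: lw; rewrite /= ?subrr ?normr0 //; have -> : c + s - (x0 + s) = c - x0 by lra.
  have h2 : `|w (c, y) - w (x0, y)| <= `|x - x0|.
    by apply: lw; rewrite /= ?subrr ?normr0.
  have -> : w (c + s, y) - w (c, y) - (w (x0 + s, y) - w (x0, y)) =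
    w (c + s, y) - w (x0 + s, y) - (w (c, y) - w (x0, y)) by lra.
  by apply: le_trans (ler_normB _ _) _; lra.
- move=> x y y' h; have [t ht e] := vdiff x y x y'.
  by apply/eqP; rewrite -subr_eq0 e h // subrr.
Qed.

End Smoothing.

(** * Admissible pairs: convexity and existence *)

Section Admissible.
Context {R : realType}.
Variables (tr : R * R -> R * R) (K : set (R * R)).

(* [w] is within [e] of the second coordinate, and near [K] it varies only in the direction of the
   first coordinate, with partial derivative [D]. *)
Record admissible (e : R) (w D : R * R -> R) : Prop := Admissible {
  adm_near : forall p, `|w p - (tr p).2| <= e;
  adm_lip : lip 1 w;
  adm_bound : forall p, `|D p| <= 1;
  adm_dlip : exists2 L, 0 <= L & lip L D;
  adm_expand : exists L s, [/\ 0 <= L, 0 < s & forall k p q, K k -> dist2 k p < s -> dist2 p q < s ->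
    `|w q - w p - D p * ((tr q).1 - (tr p).1)| <= L * dist2 p q ^+ 2] }.

Lemma admissible_le e e' w D : e <= e' -> admissible e w D -> admissible e' w D.
Proof. by move=> ee [h1 h2 h3 h4 h5]; split => // p; exact: le_trans (h1 p) ee. Qed.

(** Convexity, which makes the midpoint a competitor in the minimization of the energy. *)
Lemma admissible_mid e w D w' D' : admissible e w D -> admissible e w' D' ->
  admissible e (fun p => (w p + w' p) / 2) (fun p => (D p + D' p) / 2).
Proof.
have half (a b c : R) : `|a| <= c -> `|b| <= c -> `|(a + b) / 2| <= c.
  by rewrite !ler_norml => /andP[? ?] /andP[? ?]; apply/andP; split; lra.
move=> [h1 h2 h3 [L L0 h4] [M [s [M0 s0 h5]]]].
move=> [h1' h2' h3' [L' L0' h4'] [M' [s' [M0' s0' h5']]]]; split.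
- by move=> p; have := half _ _ _ (h1 p) (h1' p); congr (`|_| <= _); lra.
- by move=> p q; have := half _ _ _ (h2 p q) (h2' p q); congr (`|_| <= _); lra.
- by move=> p; exact: half.
- exists (L + L'); first by lra.
  move=> p q; have d0 := dist2_ge0 p q.
  have e1 : `|D p - D q| <= (L + L') * dist2 p q by apply: le_trans (h4 p q) _; nra.
  have e2 : `|D' p - D' q| <= (L + L') * dist2 p q by apply: le_trans (h4' p q) _; nra.
  by have := half _ _ _ e1 e2; congr (`|_| <= _); lra.
- exists (M + M'), (Num.min s s'); split; [lra|by rewrite lt_min s0|].
  move=> k p q Kk; rewrite !lt_min => /andP[a1 a2] /andP[b1 b2].
  have d0 : 0 <= dist2 p q ^+ 2 by rewrite sqr_ge0.
  have := half _ _ ((M + M') * dist2 p q ^+ 2)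
    (le_trans (h5 k p q Kk a1 b1) _) (le_trans (h5' k p q Kk a2 b2) _).
  have e1 : M * dist2 p q ^+ 2 <= (M + M') * dist2 p q ^+ 2 by nra.
  have e2 : M' * dist2 p q ^+ 2 <= (M + M') * dist2 p q ^+ 2 by nra.
  by move=> /(_ e1 e2); congr (`|_| <= _); lra.
Qed.

(** Collapsing strips of width [e / 8] costs [e / 2], and smoothing at scale [s] costs at most
    another [e / 2]. Near [K] flatness replaces the height of [Q] by that of [P], which leaves a
    one-variable expansion. *)
Lemma thin_admissible e : isometric tr -> thin tr K -> 0 < e -> exists w D, admissible e w D.
Proof.
move=> ti tK e0; have e8 : 0 < e / 8 by lra.
have [l [gl wl Kl]] := tK _ e8.
have [w [lw wb _ wf]] := collapse gl.
have [r r0 hr] := flat_margin gl wf.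
(* Two steps of length below [s] from a point of [K] and a shift up to [s] stay within
   [3 * s < r]. *)
pose s := Num.min (r / 4) (e / 2).
have s0 : 0 < s by rewrite lt_min !divr_gt0.
have [sr se] : s <= r / 4 /\ s <= e / 2 by split; rewrite ge_min lexx ?orbT.
have [v [lv vw dv fv]] := smoothing lw s0.
pose D p := (w (p.1 + s, p.2) - w p) / s.
have is0 : 0 < s^-1 by rewrite invr_gt0.
exists (v \o tr), (D \o tr); split.
- move=> p /=; have /andP[b1 b2] := wb (tr p); have := vw (tr p).
  have := width_ge0 gl.
  by rewrite !ler_norml => w0 /andP[c1 c2]; apply/andP; split; lra.
- by move=> p q; rewrite mul1r -ti; apply: lv; [exact: dist2_fst|exact: dist2_snd].
- move=> p /=; rewrite /D normrM [`|s^-1|]gtr0_norm // ler_pdivrMr // mul1r.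
  apply: lw => /=; last by rewrite subrr normr0 ltW.
  by rewrite addrAC subrr add0r gtr0_norm.
- exists (2 / s); first by rewrite divr_ge0 // ltW.
  move=> p q /=; rewrite -ti /D -mulrBl normrM [`|s^-1|]gtr0_norm // mulrAC ler_wpM2r ?(ltW is0) //.
  set P := tr p; set Q := tr q.
  have h1 : `|w (P.1 + s, P.2) - w (Q.1 + s, Q.2)| <= dist2 P Q.
    apply: lw => /=; last exact: dist2_snd.
    by have -> : P.1 + s - (Q.1 + s) = P.1 - Q.1 by [lra]; exact: dist2_fst.
  have h2 : `|w P - w Q| <= dist2 P Q by apply: lw; [exact: dist2_fst|exact: dist2_snd].
  have -> : w (P.1 + s, P.2) - w P - (w (Q.1 + s, Q.2) - w Q) =
    w (P.1 + s, P.2) - w (Q.1 + s, Q.2) - (w P - w Q) by lra.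
  by apply: le_trans (ler_normB _ _) _; lra.
- exists (2 / s), s; split => //; first by rewrite divr_ge0 // ltW.
  move=> k p q Kk; rewrite -(ti k p) -(ti p q) /=.
  set k' := tr k; set P := tr p; set Q := tr q => kP PQ.
  have -> : v Q = v (Q.1, P.2).
    have {1}-> : Q = (Q.1, Q.2) by case: (Q).
    apply: fv => t /andP[t0 ts].
    have a1 := dist2_lt_fst kP; have a2 := dist2_lt_snd kP.
    have b1 := dist2_lt_fst PQ; have b2 := dist2_lt_snd PQ.
    apply: hr (Kl k Kk) _ _ _ _ _ _; rewrite -/k'.
    + by move: a1 b1; rewrite ltr_norml ltr_norml ler_norml => /andP[? ?] /andP[? ?]; apply/andP; split; lra.
    + by move: a2 b2; rewrite ltr_norml ltr_norml ler_norml => /andP[? ?] /andP[? ?]; apply/andP; split; lra.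
    + by move: a2 b2; rewrite ltr_norml ltr_norml ler_norml => /andP[? ?] /andP[? ?]; apply/andP; split; lra.
  apply: le_trans (dv P Q.1) _; rewrite ler_wpM2l ?divr_ge0 ?(ltW s0) //.
  rewrite ler_pXn2r ?nnegrE ?dist2_ge0 // distrC; exact: dist2_fst.
Qed.

End Admissible.

(** * Increments and measurability along curves parametrized by arc length *)

Section Curves.
Context {R : realType}.

Lemma arclength_dist (gam : R -> R * R) a b : arclength_param gam a b ->
  forall s t, a <= s -> s <= t -> t <= b -> dist2 (gam s) (gam t) <= t - s.
Proof.
move=> [ab h] s t hs st ht; rewrite -lee_fin -(h s t hs st ht).
apply: ereal_sup_ubound; exists 1%N, (fun i => if i is 0%N then s else t); split => //.
  by case.
by rewrite big_ord_recl big_ord0 addr0.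
Qed.

Local Notation lbg := (@lebesgue_measure R).

Lemma integral_split (G : R -> \bar R) (a m b : R) : a <= m -> m <= b ->
  measurable_fun `[a, b] G -> (forall x, 0 <= G x)%E ->
  (\int[lbg]_(x in `[a, b]) G x = \int[lbg]_(x in `[a, m]) G x + \int[lbg]_(x in `[m, b]) G x)%E.
Proof.
move=> am mb mG G0.
have e : `[a, b]%classic = `[a, m] `|` `]m, b].
  apply/seteqP; split => x /=; rewrite !in_itv /=.
    by move=> /andP[ax xb]; have [xm|mx] := leP x m; [left|right]; apply/andP.
  by move=> [/andP[h1 h2]|/andP[h1 h2]]; apply/andP; split; lra.
rewrite e in mG *.
rewrite ge0_integral_setU //=.
  congr (_ + _)%E; apply: integral_itv_obnd_cbnd.
  by apply: measurable_funS mG => //; exact: measurableU.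
rewrite disj_set2E; apply/eqP/seteqP; split => // x /=; rewrite !in_itv /=.
by move=> [/andP[h1 h2] /andP[h3 h4]]; lra.
Qed.

(** An estimate on short pieces, with an error proportional to their length, adds up along the
    curve; no differentiability of the curve is involved. *)
Lemma increment_le_integral (h : R -> R) (G : R -> \bar R) (a b eta tau : R) :
  0 < tau -> measurable_fun `[a, b] G -> (forall x, 0 <= G x)%E ->
  (forall s t, a <= s -> s <= t -> t <= b -> t - s <= tau ->
    (`|h t - h s|%:E <= \int[lbg]_(x in `[s, t]) G x + (eta * (t - s))%:E)%E) ->
  a <= b -> (`|h b - h a|%:E <= \int[lbg]_(x in `[a, b]) G x + (eta * (b - a))%:E)%E.
Proof.
move=> tau0 mG G0 loc ab.
suff key (n : nat) s : a <= s -> s <= b -> b - s <= n%:R * tau ->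
    (`|h b - h s|%:E <= \int[lbg]_(x in `[s, b]) G x + (eta * (b - s))%:E)%E.
  apply: (key (Num.bound ((b - a) / tau)) a) => //.
  rewrite -ler_pdivrMr //; apply: ltW; apply: archi_boundP.
  by rewrite divr_ge0 ?subr_ge0 // ltW.
elim: n s => [|n IH] s hs sb; first by rewrite mul0r => h1; apply: loc => //; lra.
rewrite -natr1 mulrDl mul1r => hn.
have [h1|h1] := leP (b - s) tau; first exact: loc.
have mS : measurable_fun `[s, b] G.
  apply: measurable_funS mG => // x /=; rewrite !in_itv /= => /andP[h2 h3].
  by apply/andP; split; lra.
rewrite (@integral_split G s (s + tau) b) //; [|lra|lra].
have i1 : (`|h (s + tau) - h s|%:E <=
  \int[lbg]_(x in `[s, (s + tau)%R]) G x + (eta * (s + tau - s))%:E)%E by apply: loc; lra.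
have i2 : (`|h b - h (s + tau)|%:E <=
  \int[lbg]_(x in `[(s + tau)%R, b]) G x + (eta * (b - (s + tau)))%:E)%E by apply: IH; lra.
apply: (@le_trans _ _ (`|h (s + tau) - h s|%:E + `|h b - h (s + tau)|%:E)%E).
  by rewrite -EFinD lee_fin [leRHS]addrC; have := ler_distD (h (s + tau)) (h b) (h s).
apply: le_trans (leeD i1 i2) _; rewrite addeACA; apply: leeD2l.
by rewrite -EFinD lee_fin -mulrDr; have -> : s + tau - s + (b - (s + tau)) = b - s by lra.
Qed.

(** A curve is arbitrary outside [[a, b]]; clamping the parameter makes it 1-Lipschitz on the whole
    line. *)
Lemma clamp_curve_measurable (gam : R -> R * R) a b : a <= b ->
  (forall s t, a <= s -> s <= t -> t <= b -> dist2 (gam s) (gam t) <= t - s) ->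
  measurable_fun [set: R] (fun t => gam (Num.max a (Num.min t b))).
Proof.
move=> ab gl; pose c (t : R) := Num.max a (Num.min t b).
have c1 t : a <= c t <= b by rewrite /c le_max lexx /= ge_max ab ge_min lexx orbT.
have c2 s t : `|c s - c t| <= `|s - t|.
  apply: dist_max; first by rewrite subrr normr0.
  by apply: dist_min => //; rewrite subrr normr0.
have gc s t : dist2 (gam (c s)) (gam (c t)) <= `|s - t|.
  have /andP[a1 a2] := c1 s; have /andP[b1 b2] := c1 t.
  apply: le_trans (c2 s t); have [st|ts] := leP (c s) (c t).
    by apply: le_trans (gl _ _ _ _ _) _ => //; rewrite distrC ler_norm.
  by rewrite dist2C; apply: le_trans (gl _ _ _ (ltW ts) _) _ => //; rewrite ler_norm.
have cont (f : R -> R) : (forall s t, `|f s - f t| <= `|s - t|) -> measurable_fun [set: R] f.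
  move=> hf; apply: continuous_measurable_fun => x; apply/cvgrPdist_lt => e e0; near=> z.
  by apply: le_lt_trans (hf _ _) _; near: z; apply: cvgr_dist_lt => //; exact: cvg_id.
apply/measurable_fun_pairP; split; apply: cont => s t /=.
  exact: le_trans (dist2_fst _ _) (gc s t).
exact: le_trans (dist2_snd _ _) (gc s t).
Unshelve. all: by end_near. Qed.

End Curves.

(** * An upper gradient of an admissible function minus a linear one *)

Section UpperGradient.
Context {R : realType}.
Variables (tr : R * R -> R * R) (K : set (R * R)).

(** For [w] minus [c] times the first coordinate: the slope near [K] is [D - c], and elsewhere the
    Lipschitz constant is at most [1 + |c| <= 2]. *)
Definition grad (D : R * R -> R) (c s : R) (p : R * R) : R :=
  `|D p - c| + 2 * \1_(~` nbhd2 K s) p.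

Lemma grad_ge0 D c s p : 0 <= grad D c s p.
Proof. by rewrite addr_ge0 // mulr_ge0 // indicE. Qed.

Lemma grad_measurable D c s L : lip L D -> measurable_fun [set: R * R] (grad D c s).
Proof.
move=> lD; apply: measurable_funD.
  apply: measurableT_comp => //; apply: measurable_funB => //; exact: lip_measurable lD.
apply: measurable_funM => //; apply: measurable_indic; apply: measurableC; exact: nbhd2_measurable.
Qed.

Lemma isometric_fst p q : isometric tr -> `|(tr p).1 - (tr q).1| <= dist2 p q.
Proof. by move=> ti; rewrite -ti; exact: dist2_fst. Qed.

Lemma upper_gradient_adm e w D c : isometric tr -> admissible tr K e w D -> `|c| <= 1 ->
  exists2 s, 0 < s & upper_gradient (fun p => w p - c * (tr p).1) (fun p => (grad D c s p)%:E).
Proof.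
move=> ti [_ wl Db [M M0 Dl] [L [s0 [L0 s00 wx]]]] c1.
pose s := s0 / 2; have s_gt0 : 0 < s by rewrite /s; lra.
exists s => //; split; first by apply/measurable_EFinP; exact: grad_measurable Dl.
split=> [p|gam a b garc]; first by rewrite lee_fin grad_ge0.
have [ab _] := garc; have gl := arclength_dist garc.
set v := fun p => w p - c * (tr p).1.
have vl p q : `|v q - v p| <= 2 * dist2 p q.
  have := wl q p; have := isometric_fst q p ti; rewrite [dist2 q p]dist2C mul1r => h1 h2.
  have -> : v q - v p = w q - w p - c * ((tr q).1 - (tr p).1) by rewrite /v; lra.
  apply: le_trans (ler_normB _ _) _; rewrite normrM.
  have : `|c| * `|(tr q).1 - (tr p).1| <= 1 * dist2 p q by apply: ler_pM.
  by lra.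
have vx k p q h : K k -> dist2 k p < s0 -> dist2 p q <= h -> h < s0 ->
    `|v q - v p| <= (`|D p - c| + L * h) * h.
  move=> Kk kp pq hs; have d0 := dist2_ge0 p q; have h0 := le_trans d0 pq.
  have -> : v q - v p = w q - w p - D p * ((tr q).1 - (tr p).1) +
     (D p - c) * ((tr q).1 - (tr p).1) by rewrite /v; lra.
  apply: le_trans (ler_normD _ _) _; rewrite normrM addrC mulrDl; apply: lerD.
    apply: ler_wpM2l => //; apply: le_trans pq; rewrite [leRHS]dist2C.
    exact: isometric_fst.
  apply: le_trans (wx _ _ _ Kk kp (le_lt_trans pq hs)) _.
  by rewrite -mulrA; apply: ler_wpM2l => //; rewrite -expr2 ler_pXn2r ?nnegrE.
pose G t := ((grad D c s (gam t))%:E : \bar R).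
pose cl t := Num.max a (Num.min t b).
have clE t : t \in `[a, b] -> cl t = t.
  by rewrite in_itv /= => /andP[h1 h2]; rewrite /cl min_l // max_r.
have mG : measurable_fun `[a, b] G.
  apply: (eq_measurable_fun (fun t => (grad D c s (gam (cl t)))%:E)).
    by move=> t; rewrite inE => /clE ->.
  apply: measurable_funTS; apply/measurable_EFinP.
  apply: measurableT_comp; first exact: grad_measurable Dl.
  exact: clamp_curve_measurable.
have G0 t : (0 <= G t)%E by rewrite lee_fin grad_ge0.
apply/lee_addgt0Pr => eps eps0.
(* The bound by [s / 2] keeps a piece that starts outside the [s0]-neighbourhood of [K] out of the
   [s]-neighbourhood, as [s0 = 2 * s]; the other bound keeps the accumulated error below [eps]. *)
pose tau := Num.min (s / 2) (eps / ((L + M) * (b - a) + 1)).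
have LM0 : 0 <= (L + M) * (b - a) by apply: mulr_ge0 (addr_ge0 L0 M0) _; rewrite subr_ge0.
have den0 : 0 < (L + M) * (b - a) + 1 by lra.
have tau0 : 0 < tau by rewrite lt_min !divr_gt0.
have [ts te] : tau <= s / 2 /\ tau * ((L + M) * (b - a) + 1) <= eps.
  split; first by rewrite ge_min lexx.
  by rewrite -ler_pdivlMr // ge_min lexx orbT.
have := @increment_le_integral R (v \o gam) G a b ((L + M) * tau) tau tau0 mG G0.
move=> /(_ _ ab) h; apply: le_trans (h _) _; last first.
  apply: leeD2l; rewrite lee_fin; nra.
move=> {h} t t' at_ tt' t'b htau.
have mGt : measurable_fun `[t, t'] G.
  apply: measurable_funS mG => // x /=; rewrite !in_itv /= => /andP[h2 h3].
  by apply/andP; split; lra.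
have lower (m : R) : 0 <= m -> (forall u, t <= u -> u <= t' -> m <= grad D c s (gam u)) ->
    ((m * (t' - t))%:E <= \int[lebesgue_measure]_(x in `[t, t']) G x)%E.
  move=> m0 hm; apply: (@le_trans _ _ (\int[lebesgue_measure]_(x in `[t, t']) (cst m%:E x))%E).
    rewrite integral_cst //= lebesgue_measure_itv /= lte_fin.
    case: ltP => [_|h]; first by rewrite -EFinB -EFinM.
    by rewrite mule0 lee_fin; have -> : t' = t; [lra|rewrite subrr mulr0].
  apply: ge0_le_integral => //.
  by move=> x /=; rewrite in_itv /= => /andP[h1 h2]; rewrite lee_fin hm.
have gd u : t <= u -> u <= t' -> dist2 (gam t) (gam u) <= tau.
  by move=> h1 h2; have := gl t u at_ h1 (le_trans h2 t'b); lra.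
have gtt := gl t t' at_ tt' t'b.
have t0 : 0 <= t' - t by lra.
have [[k Kk kt]|nK] := pselect (nbhd2 K s0 (gam t)).
  have h1 := vx k _ _ _ Kk kt gtt; have {}h1 := h1 ltac:(rewrite /s in ts; lra).
  (* Near [K]: [L * tau] comes from the expansion and [M * tau] from the variation of [D] along the
     piece. The maximum with 0 keeps the constant under the integral nonnegative. *)
  have h2 : `|v (gam t') - v (gam t)| <=
      Num.max 0 (`|D (gam t) - c| - M * tau) * (t' - t) + (L + M) * tau * (t' - t).
    apply: le_trans h1 _; rewrite -mulrDl; apply: ler_wpM2r => //.
    have : `|D (gam t) - c| - M * tau <= Num.max 0 (`|D (gam t) - c| - M * tau).
      by rewrite le_max lexx orbT.
    have : L * (t' - t) <= L * tau by apply: ler_wpM2l.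
    by lra.
  apply: (@le_trans _ _ ((Num.max 0 (`|D (gam t) - c| - M * tau) * (t' - t))%:E
     + ((L + M) * tau * (t' - t))%:E)%E); first by rewrite -EFinD lee_fin.
  apply: leeD2r; apply: lower; first by rewrite le_max lexx.
  move=> u tu ut; rewrite ge_max grad_ge0 /=.
  have h3 := Dl (gam t) (gam u).
  have h4 : M * dist2 (gam t) (gam u) <= M * tau by apply: ler_wpM2l => //; exact: gd.
  have := ler_distD (D (gam u)) (D (gam t)) c.
  have : 0 <= 2 * \1_(~` nbhd2 K s) (gam u) :> R by rewrite mulr_ge0 // indicE.
  by rewrite /grad; lra.
apply: (@le_trans _ _ (2 * (t' - t))%:E).
  by rewrite lee_fin; apply: le_trans (vl _ _) _; lra.
apply: (@le_trans _ _ (\int[lebesgue_measure]_(x in `[t, t']) G x)%E); last first.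
  rewrite leeDl // lee_fin; apply: mulr_ge0 => //.
  by apply: mulr_ge0 (ltW tau0); exact: addr_ge0.
apply: lower => // u tu ut; rewrite /grad indicE mem_set ?mulr1 ?lerDr //.
move=> [k Kk ku]; apply: nK; exists k => //.
apply: le_lt_trans (dist2_triangle (gam u) _ _) _; rewrite [dist2 (gam u) _]dist2C.
by have := gd u tu ut; rewrite /ball2/= in ku; rewrite /s in ku ts; lra.
Qed.

End UpperGradient.

(** * Minimizing the energy of the slope *)

Section NearMinimal.
Context {R : realType}.
Variables (mu : {measure set (R * R)%type -> \bar R}) (tr : R * R -> R * R) (K : set (R * R)).
Hypotheses (mK : measurable K) (Kfin : (mu K < +oo)%E).

Lemma bounded_integrable (f : R * R -> R) (A : set (R * R)) (M : R) : measurable A ->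
  (mu A < +oo)%E -> measurable_fun [set: R * R] f -> (forall p, A p -> `|f p| <= M) ->
  mu.-integrable A (EFin \o f).
Proof.
move=> mA Afin mf fM; apply: measurable_bounded_integrable => //.
  exact: measurable_funTS.
exists M; split; first exact: num_real.
by move=> x Mx p Ap; apply: le_trans (fM p Ap) (ltW Mx).
Qed.

Definition energy (D : R * R -> R) := \int[mu]_(p in K) (D p ^+ 2).

Lemma sqr_bounded_integrable (D : R * R -> R) (M : R) : measurable_fun [set: R * R] D ->
  (forall p, `|D p| <= M) -> mu.-integrable K (EFin \o (fun p => D p ^+ 2)).
Proof.
move=> mD DM; apply: (@bounded_integrable _ _ (M ^+ 2)) => //.
  by apply: measurable_funX.
move=> p _; rewrite normrX ler_pXn2r ?nnegrE //; exact: le_trans (DM p).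
Qed.

Lemma adm_measurable e w D : admissible tr K e w D -> measurable_fun [set: R * R] D.
Proof. by case=> _ _ _ [L _ h] _; exact: lip_measurable h. Qed.

(* Parallelogram identity; it replaces weak compactness in L^2: minimizing the energy over the
   convex sets of admissible pairs makes the gradients Cauchy. *)
Lemma near_minimal (delta : R) : (forall e : R, 0 < e -> exists w D, admissible tr K e w D) ->
  0 < delta -> exists w D, admissible tr K 1 w D /\ forall e, 0 < e ->
    exists w1 D1, admissible tr K e w1 D1 /\ energy (fun p => D1 p - D p) <= delta.
Proof.
move=> ex d0.
(* The supremum of [S] is the limit, as [e] tends to 0, of the infimum of the energy over the
   admissible pairs at level [e]. *)
pose S := [set r : R | exists e, [/\ 0 < e, e <= 1 & forall w D, admissible tr K e w D -> r <= energy D]].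
have S0 : S 0.
  exists 1; split => // w D _; apply: Rintegral_ge0 => p _; exact: sqr_ge0.
have Sub : ubound S (fine (mu K)).
  move=> r [e [e0 _ h]]; have [w [D aD]] := ex e e0; apply: le_trans (h _ _ aD) _.
  have -> : fine (mu K) = \int[mu]_(p in K) cst 1 p.
    by rewrite Rintegral_cst // mul1r.
  apply: le_Rintegral => //.
  - exact: sqr_bounded_integrable (adm_measurable aD) (adm_bound aD).
  - by apply: (@bounded_integrable _ _ 1) => // p _; rewrite normr1.
  - move=> p _; have := adm_bound aD p; rewrite ler_norml => /andP[h1 h2].
    by rewrite /= expr2; nra.
have hS : has_sup S by split; [exists 0|exists (fine (mu K))].
(* Energies below [d + eta] and a midpoint energy above [d - eta] give a squared distance at most
   [4 * (d + eta) - 4 * (d - eta) = delta]. *)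
pose d := sup S; pose eta := delta / 8.
have eta0 : 0 < eta by rewrite /eta; lra.
have [r [e0 [e00 e01 hr]] rd] := sup_adherent eta0 hS.
have below e : 0 < e -> e <= e0 -> exists w D, admissible tr K e w D /\ energy D < d + eta.
  move=> e_gt0 ee0; apply: contrapT => h.
  have : S (d + eta).
    exists e; split => //; first exact: le_trans e01.
    move=> w D aD; rewrite leNgt; apply/negP => hD; apply: h; by exists w, D.
  by move=> /(ub_le_sup hS.2); rewrite -/d; lra.
have [w [D [aD eD]]] := below e0 e00 (lexx _).
exists w, D; split; first exact: admissible_le aD.
move=> e e_gt0.
have [||w1 [D1 [aD1 eD1]]] := below (Num.min e e0).
- by rewrite lt_min e_gt0.
- by rewrite ge_min lexx orbT.
exists w1, D1; split; first by apply: admissible_le aD1; rewrite ge_min lexx.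
have aD1' : admissible tr K e0 w1 D1 by apply: admissible_le aD1; rewrite ge_min lexx orbT.
have := hr _ _ (admissible_mid aD aD1').
have mD := adm_measurable aD; have mD1 := adm_measurable aD1.
have i1 := sqr_bounded_integrable mD (adm_bound aD).
have i2 := sqr_bounded_integrable mD1 (adm_bound aD1).
have i3 : mu.-integrable K (EFin \o (fun p => (D1 p - D p) ^+ 2)).
  apply: (@sqr_bounded_integrable _ 2); first exact: measurable_funB.
  move=> p; have := adm_bound aD p; have := adm_bound aD1 p.
  by have := ler_normB (D1 p) (D p); lra.
have i4 : mu.-integrable K (EFin \o (fun p => ((D p + D1 p) / 2) ^+ 2)).
  apply: (@sqr_bounded_integrable _ 1); first by apply: measurable_funM => //; exact: measurable_funD.
  exact: adm_bound (admissible_mid aD aD1').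
have -> : energy (fun p => D1 p - D p) =
    2 * energy D + 2 * energy D1 - 4 * energy (fun p => (D p + D1 p) / 2).
  rewrite /energy -!RintegralZl // -RintegralD //; last 2 first.
    exact: (integrableZl mK 2 i1).
    exact: (integrableZl mK 2 i2).
  rewrite -RintegralB //; last 2 first.
  - by have := integrableD mK (integrableZl mK 2 i1) (integrableZl mK 2 i2).
  - exact: (integrableZl mK 4 i4).
  by apply: eq_Rintegral => p _; rewrite !expr2; lra.
by rewrite -/d in rd; rewrite /eta in eD eD1 rd; lra.
Qed.

End NearMinimal.

(** * Consequences of doubling: oscillation from below, and a ball with small mean *)

Section Oscillation.
Context {R : realType}.
Variable mu : {measure set (R * R)%type -> \bar R}.
Variables (kappa : R).
Hypothesis fin : forall p r, (mu (ball2 p r) < +oo)%E.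
Hypothesis kappa1 : 1 <= kappa.
Hypothesis dbl : forall p (r : R), 0 < r -> (mu (ball2 p (2 * r)) <= kappa%:E * mu (ball2 p r))%E.

Lemma ball2_fin_num p r : mu (ball2 p r) \is a fin_num.
Proof. by rewrite ge0_fin_numE // fin. Qed.

Lemma kappa_gt0 : 0 < kappa.
Proof. exact: lt_le_trans ltr01 kappa1. Qed.

Lemma doubling_iter n p (r : R) : 0 < r -> (mu (ball2 p (2 ^+ n * r)) <= (kappa ^+ n)%:E * mu (ball2 p r))%E.
Proof.
move=> r0; elim: n => [|n IH]; first by rewrite !expr0 !mul1r mul1e.
rewrite exprS -mulrA; apply: le_trans (dbl _ _) _; first by rewrite mulr_gt0 // exprn_gt0.
rewrite exprS EFinM -muleA; apply: lee_wpmul2l => //.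
by rewrite lee_fin ltW // kappa_gt0.
Qed.

(** The points at height [r / 2] above and below the centre have values of the linear function
    differing by [r], so one is [r / 2] away from [m]. On the ball of radius [r / 8] about it the
    deviation is at most [r / 16 + r / 8 + r / 8], leaving [3 * r / 16]; four doublings compare this
    ball with the whole one. *)
Lemma oscillation_lower (tr : R * R -> R * R) (v : R * R -> R) (z : R * R) (c r m : R) :
  isometric tr -> (forall p, tr (tr p) = p) -> measurable_fun [set: R * R] v ->
  0 < r -> `|c| <= 1 ->
  (forall p, `|v p - ((tr p).2 - c * (tr p).1)| <= r / 16) ->
  ((3 * r / 16 / kappa ^+ 4)%:E * mu (ball2 z r) <= \int[mu]_(p in ball2 z r) (`|v p - m|)%:E)%E.
Proof.
move=> ti tt mv r0 c1 vb.
pose pt (s : R) := tr ((tr z).1, (tr z).2 + s).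
have dpt s : dist2 z (pt s) = `|s|.
  rewrite /pt -[X in dist2 X _]tt ti /dist2 /= subrr expr0n /= add0r.
  by rewrite sqrtr_sqr opprD addrA subrr add0r normrN.
have k4 : 0 < kappa ^+ 4 by rewrite exprn_gt0 // kappa_gt0.
pose B s := ball2 (pt s) (r / 8).
have BB s : `|s| = r / 2 -> (mu (ball2 z r) <= (kappa ^+ 4)%:E * mu (B s))%E.
  move=> hs; have r8 : 0 < r / 8 by lra.
  apply: le_trans (doubling_iter 4 (pt s) r8).
  apply: le_measure; rewrite ?inE; [exact: ball2_measurable|exact: ball2_measurable|].
  by apply: ball2_sub; rewrite dist2C dpt hs; lra.
have low s p : B s p -> `|v p - ((tr z).2 - c * (tr z).1) - s| <= 5 * r / 16.
  rewrite /B /ball2 /= -ti /pt tt => h; have := dist2_lt_fst h; have := dist2_lt_snd h => /= h2 h1.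
  have h3 := vb p.
  have h4 : `|c * ((tr z).1 - (tr p).1)| <= r / 8.
    by rewrite normrM; have := ler_pM (normr_ge0 _) (normr_ge0 _) c1 (ltW h1); rewrite mul1r.
  have -> : v p - ((tr z).2 - c * (tr z).1) - s = v p - ((tr p).2 - c * (tr p).1)
     + (c * ((tr z).1 - (tr p).1) - ((tr z).2 + s - (tr p).2)) by lra.
  apply: le_trans (ler_normD _ _) _.
  have := ler_normB (c * ((tr z).1 - (tr p).1)) ((tr z).2 + s - (tr p).2).
  by lra.
have sub s : `|s| = r / 2 -> (forall p, B s p -> 3 * r / 16 <= `|v p - m|) ->
  ((3 * r / 16 / kappa ^+ 4)%:E * mu (ball2 z r) <= \int[mu]_(p in ball2 z r) (`|v p - m|)%:E)%E.
  move=> hs hB.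
  have mvm A : measurable_fun A (fun p => (`|v p - m|)%:E).
    apply: measurable_funTS; apply/measurable_EFinP; apply: measurableT_comp => //.
    exact: measurable_funB.
  have mB : measurable (B s) by exact: ball2_measurable.
  apply: (@le_trans _ _ (\int[mu]_(p in B s) (cst (3 * r / 16)%:E p))%E).
    rewrite integral_cst // EFinM -muleA; apply: lee_wpmul2l; first by rewrite lee_fin; lra.
    by rewrite muleC lee_pdivrMr // muleC; exact: BB.
  apply: (@le_trans _ _ (\int[mu]_(p in B s) (`|v p - m|)%:E)%E).
    apply: ge0_le_integral => //.
    by move=> p _; rewrite /= lee_fin; lra.
  apply: ge0_subset_integral => //; first exact: ball2_measurable.
  by apply: ball2_sub; rewrite dpt hs; lra.
have [h|h] := leP m ((tr z).2 - c * (tr z).1).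
  apply: (sub (r / 2)); first by rewrite gtr0_norm; lra.
  move=> p /low; rewrite ler_norml => /andP[h1 h2].
  by apply: le_trans (ler_norm _); lra.
apply: (sub (- (r / 2))); first by rewrite normrN gtr0_norm; lra.
move=> p /low; rewrite ler_norml => /andP[h1 h2].
by rewrite distrC; apply: le_trans (ler_norm _); lra.
Qed.

(* Disjoint balls of radius [rho] around a separated net of [K] carry, by doubling, a fixed fraction of
   [mu K], so [H] cannot exceed twice its mean on all of them. *)
Lemma good_ball (K U : set (R * R)) (H : R * R -> \bar R) (rho : R) (a : R) : compact K ->
  (0 < mu K)%E -> measurable U -> measurable_fun [set: R * R] H -> (forall p, 0 <= H p)%E ->
  0 < rho -> 0 <= a ->
  (forall z, K z -> ball2 z rho `<=` U) -> (\int[mu]_(p in U) H p <= a%:E * mu K)%E ->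
  exists z, K z /\ (\int[mu]_(p in ball2 z rho) H p <= (2 * a * kappa ^+ 2)%:E * mu (ball2 z rho))%E.
Proof.
move=> cK K0 mU mH H0 rho0 a0 KU HU.
have rho2 : 0 < 2 * rho by lra.
(* Separation [2 * rho] makes the balls of radius [rho] disjoint; those of radius [4 * rho] cover
   [K], whence [kappa ^+ 2]. *)
have [s [ss sK Ks]] := separated_net cK rho2.
pose I A := (\int[mu]_(p in A) H p)%E.
have clK : closed K by exact: compact_closed hausdorff2 cK.
have half : 2 * rho / 2 = rho by lra.
have cover : (mu K <= (kappa ^+ 2)%:E * \sum_(z <- s) mu (ball2 z rho))%E.
  rewrite ge0_sume_distrr //.
  apply: (@le_trans _ _ (\sum_(z <- s) mu (ball2 z (2 ^+ 2 * rho))))%E; last first.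
    by apply: lee_sum => z _; exact: doubling_iter.
  apply: (@le_trans _ _ (mu (\big[setU/set0]_(z <- s) ball2 z (2 ^+ 2 * rho)))).
    apply: le_measure; rewrite ?inE; first exact: closed_measurable2.
      by apply: bigsetU_measurable => z _; exact: ball2_measurable.
    move=> p /Ks[q qs qp]; rewrite -bigcup_seq; exists q => //.
    by apply: lt_le_trans qp _; rewrite expr2; lra.
  elim: (s) => [|z s' IH]; first by rewrite !big_nil measure0.
  rewrite !big_cons; apply: le_trans (leeD2l _ IH).
  apply: measureU2; first exact: ball2_measurable.
  by apply: bigsetU_measurable => z' _; exact: ball2_measurable.
have disj : (\sum_(z <- s) I (ball2 z rho) <= a%:E * mu K)%E.
  apply: le_trans HU.
  have := @separated_sum R I (2 * rho) s; rewrite half /I integral_set0 => /(_ (lexx _)) h.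
  apply: le_trans (h _ ss) _.
    move=> A B mA mB AB; rewrite ge0_integral_setU //; first exact: measurable_funTS.
    by rewrite disj_set2E AB.
  apply: ge0_subset_integral => //.
  - by apply: bigsetU_measurable => z _; exact: ball2_measurable.
  - exact: measurable_funTS.
  - by move=> p; rewrite -bigcup_seq => -[z /= /sK Kz]; exact: KU.
have muKfin : mu K \is a fin_num.
  rewrite ge0_fin_numE //; have [r _ Kr] := compact_bounded2 cK.
  apply: le_lt_trans (fin 0 r); apply: le_measure; rewrite ?inE //; last exact: ball2_measurable.
  exact: closed_measurable2.
apply: contrapT => h.
have h' z : z \in s -> ((2 * a * kappa ^+ 2)%:E * mu (ball2 z rho) <= I (ball2 z rho))%E.
  move=> /sK Kz; rewrite leNgt; apply/negP => /ltW hz; apply: h; by exists z.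
have [z zK] : exists z, K z.
  apply: contrapT => /forallNP hK; move: K0.
  by have -> : K = set0; [apply/seteqP; split|rewrite measure0 ltxx].
have ha : (2 * a%:E * mu K <= a%:E * mu K)%E.
  apply: le_trans disj; rewrite -EFinM.
  apply: (@le_trans _ _ (\sum_(z <- s) (2 * a * kappa ^+ 2)%:E * mu (ball2 z rho))%E).
    rewrite -ge0_sume_distrr // [(2 * a * _)%:E]EFinM -muleA; apply: lee_wpmul2l => //.
    by rewrite lee_fin; lra.
  by rewrite big_seq [leRHS]big_seq; apply: lee_sum => y ys; exact: h'.
have aK : (0 <= a%:E * mu K)%E by rewrite mule_ge0.
have k0 : 0 < fine (mu K) by rewrite fine_gt0 // K0 ltey_eq muKfin.
(* If every ball is bad, [2 * a * mu K <= a * mu K], which contradicts nothing when [a] is 0; in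
   that case the integral over each ball of the net vanishes. *)
have a00 : a = 0.
  move: ha; rewrite -(fineK muKfin) -!EFinM lee_fin => ha.
  by apply/eqP; rewrite eq_le a0 andbT; nra.
apply: h; have [q qs _] := Ks z zK; exists q; split; first exact: sK.
rewrite a00 mulr0 mul0r mul0e.
move: disj; rewrite a00 mul0e (big_rem q) //=; apply: le_trans.
by rewrite leeDl // sume_ge0 // => y _; apply: integral_ge0.
Qed.

End Oscillation.

(** * Estimates for the mean of the upper gradient, and the contradiction *)

Section Contradiction.
Context {R : realType}.
Variable mu : {measure set (R * R)%type -> \bar R}.

(** In place of Cauchy-Schwarz: [t <= eta + t ^+ 2 / eta], with [eta] to be chosen. *)
Lemma integral_abs_le_energy (K : set (R * R)) (E : R * R -> R) (eta M : R) :
  measurable K -> (mu K < +oo)%E -> 0 < eta -> measurable_fun [set: R * R] E ->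
  (forall p, `|E p| <= M) ->
  (\int[mu]_(p in K) (`|E p|)%:E <= (eta * fine (mu K) + energy mu K E / eta)%:E)%E.
Proof.
move=> mK Kfin eta0 mE EM.
have i1 := sqr_bounded_integrable mK Kfin mE EM.
have i2 : mu.-integrable K (EFin \o (fun p => eta^-1 * E p ^+ 2)).
  exact: (integrableZl mK eta^-1 i1).
have i3 : mu.-integrable K (EFin \o cst eta).
  by apply: (@bounded_integrable _ _ _ _ `|eta|).
have i4 : mu.-integrable K (EFin \o (fun p => eta + eta^-1 * E p ^+ 2)).
  by have := integrableD mK i3 i2.
apply: (@le_trans _ _ (\int[mu]_(p in K) (eta + eta^-1 * E p ^+ 2)%:E)%E).
  apply: ge0_le_integral => //.
  - apply: measurable_funTS; apply/measurable_EFinP; exact: measurableT_comp.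
  - by case/integrableP: i4.
  - move=> p _; rewrite lee_fin.
    have h : 0 <= (2 * `|E p| - eta) ^+ 2 / eta by rewrite divr_ge0 ?sqr_ge0 ?ltW.
    have e1 : eta^-1 * E p ^+ 2 = `|E p| ^+ 2 / eta by rewrite real_normK ?num_real // mulrC.
    have e2 : (2 * `|E p| - eta) ^+ 2 / eta = 4 * (`|E p| ^+ 2 / eta) - 4 * `|E p| + eta.
      rewrite sqrrB exprMn; field; exact: lt0r_neq0.
    by rewrite e1; lra.
rewrite -(fineK (integrable_fin_num mK i4)) lee_fin -[fine _]/(\int[mu]_(p in K) (eta + eta^-1 * E p ^+ 2)).
rewrite RintegralD // Rintegral_cst // RintegralZl //.
by rewrite /energy [_^-1 * _]mulrC.
Qed.

(** Since [g / M] lies in the unit interval, its p-th power is at most itself. *)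
Lemma powR_le_linear (g M p : R) : 0 <= g -> g <= M -> 0 < M -> 1 <= p -> g `^ p <= M `^ (p - 1) * g.
Proof.
move=> g0 gM M0 p1.
have [->|gn0] := eqVneq g 0; first by rewrite powR0 ?mulr0 // gt_eqF // (lt_le_trans ltr01).
have g_gt0 : 0 < g by rewrite lt_neqAle eq_sym gn0.
have gM0 : 0 <= g / M by rewrite divr_ge0 // ltW.
have gE : M * (g / M) = g by rewrite mulrC divfK // gt_eqF.
have MpE : M `^ (p - 1) * M = M `^ p.
  have := @powRD R M (p - 1) 1.
  by rewrite subrK powRr1 ?ltW // (gt_eqF M0) implybT => /(_ isT) ->.
have -> : M `^ (p - 1) * g = M `^ p * (g / M) by rewrite -MpE -mulrA gE.
have -> : g `^ p = M `^ p * (g / M) `^ p by rewrite -powRM ?gE // ltW.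
apply: ler_wpM2l; first exact: powR_ge0.
by apply: ge1r_powR => //; rewrite divr_gt0 //= ler_pdivrMr ?mul1r.
Qed.

(** On [K] the triangle inequality passes from [D1 y] to [D z] through [D y], and only [D] has a
    controlled Lipschitz constant. Off [K] the crude bound [1 + 1 + 2] is used. *)
Lemma grad_le (K U : set (R * R)) (D D1 : R * R -> R) (s L rho : R) (z y : R * R) :
  0 <= L -> lip L D -> (forall q, `|D q| <= 1) -> (forall q, `|D1 q| <= 1) -> 0 < s ->
  ball2 z rho y -> U y ->
  grad K D1 (D z) s y <= 4 /\
  grad K D1 (D z) s y <= L * rho + (`|D1 y - D y| * \1_K y + 4 * \1_(U `\` K) y).
Proof.
move=> L0 lD D_1 D1_1 s0 zy Uy.
have Lrho : L * dist2 y z <= L * rho by apply: ler_wpM2l => //; rewrite dist2C; apply: ltW.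
have Ld0 : 0 <= L * dist2 y z by rewrite mulr_ge0 ?dist2_ge0.
have g4 : grad K D1 (D z) s y <= 4.
  rewrite /grad; have := ler_normB (D1 y) (D z); have := D1_1 y; have := D_1 z.
  have : \1_(~` nbhd2 K s) y <= 1 :> R by rewrite indicE; case: (_ \in _).
  by lra.
split=> //; have [Ky|nKy] := pselect (K y).
  rewrite /grad !indicE (memNset (A := ~` _)); last by apply; exact: sub_nbhd2.
  rewrite mulr0 addr0 mem_set // mulr1.
  have : 0 <= (4 * (y \in U `\` K)%:R : R) by rewrite mulr_ge0.
  by have := ler_distD (D y) (D1 y) (D z); have := lD y z; lra.
rewrite [\1_(U `\` K) y]indicE mem_set //.
have : 0 <= `|D1 y - D y| * \1_K y by rewrite mulr_ge0 // indicE.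
by rewrite mulr1; lra.
Qed.

Lemma integral_powR_le (B : set (R * R)) (g H : R * R -> R) (M h p : R) : measurable B ->
  measurable_fun [set: R * R] g -> measurable_fun [set: R * R] H ->
  (forall y, 0 <= g y) -> (forall y, 0 <= H y) -> (forall y, B y -> g y <= M /\ g y <= h + H y) ->
  0 < M -> 1 <= p -> 0 <= h -> (\int[mu]_(y in B) (H y)%:E <= h%:E * mu B)%E ->
  (\int[mu]_(y in B) poweR (g y)%:E p <= (M `^ (p - 1) * (2 * h))%:E * mu B)%E.
Proof.
move=> mB mg mH g0 H0 gB M0 p1 h0 HB.
have F0 : 0 <= M `^ (p - 1) by exact: powR_ge0.
have mHB : measurable_fun B (fun y => (H y)%:E).
  by apply: measurable_funTS; apply/measurable_EFinP.
apply: (@le_trans _ _ (\int[mu]_(y in B) ((M `^ (p - 1))%:E * (h%:E + (H y)%:E)))%E).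
  apply: ge0_le_integral => //.
  - by move=> y _; exact: poweR_ge0.
  - apply: measurable_funTS; apply: (measurableT_comp (measurable_poweR p)).
    exact/measurable_EFinP.
  - by apply: emeasurable_funM => //; exact: emeasurable_funD.
  move=> y /gB[gM gh]; rewrite poweR_EFin -EFinD -EFinM lee_fin.
  by apply: le_trans (powR_le_linear (g0 y) gM M0 p1) _; exact: ler_wpM2l.
rewrite ge0_integralZl //; last 2 first.
- exact: emeasurable_funD.
- by move=> y _; rewrite adde_ge0 // lee_fin.
rewrite ge0_integralD //; last by move=> y _; rewrite lee_fin.
rewrite integral_cst // EFinM -muleA; apply: lee_wpmul2l; first by rewrite lee_fin.
have -> : 2 * h = h + h by lra.
by rewrite EFinD ge0_muleDl ?lee_fin //; exact: leeD2l.
Qed.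

Lemma lip_loc_integrable (v : R * R -> R) L : (forall p r, (mu (ball2 p r) < +oo)%E) ->
  lip L v -> loc_integrable mu v.
Proof.
move=> fin lv; have mv := lip_measurable lv; split => // x r r0.
apply: (@bounded_integrable _ _ _ _ (`|v x| + `|L| * r)) => //; first exact: ball2_measurable.
move=> p xp; have h1 := lv x p.
have h2 : L * dist2 x p <= `|L| * r.
  apply: le_trans (ler_wpM2r (dist2_ge0 _ _) (ler_norm L)) _.
  by apply: ler_wpM2l => //; apply: ltW.
by have := ler_distD (v x) 0 (v p); rewrite !sub0r !normrN; lra.
Qed.

Lemma thin_not_poincare (tr : R * R -> R * R) (K : set (R * R)) (kappa p : R) :
  isometric tr -> (forall z, tr (tr z) = z) ->
  (forall z (r : R), 0 < r -> (0 < mu (ball2 z r))%E) ->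
  (forall z r, (mu (ball2 z r) < +oo)%E) -> 1 <= kappa ->
  (forall z (r : R), 0 < r -> (mu (ball2 z (2 * r)) <= kappa%:E * mu (ball2 z r))%E) ->
  compact K -> (0 < mu K)%E -> thin tr K -> 1 <= p -> poincare mu p -> False.
Proof.
move=> ti tt pos fin k1 dbl cK K0 tK p1 [Lam [C [Lam1 [C0 hP]]]].
have k0 : 0 < kappa := kappa_gt0 k1.
have Lam0 : 0 < Lam by apply: lt_le_trans Lam1.
have p0 : 0 < p by apply: lt_le_trans p1.
have mK : measurable K by apply: closed_measurable2; exact: compact_closed hausdorff2 cK.
have Kfin : (mu K < +oo)%E.
  have [r _ Kr] := compact_bounded2 cK; apply: le_lt_trans (fin 0 r).
  by apply: le_measure; rewrite ?inE //; exact: ball2_measurable.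
have Knum : mu K \is a fin_num by rewrite ge0_fin_numE.
pose mk := fine (mu K).
have mk0 : 0 < mk by rewrite /mk fine_gt0 // K0.
have muKE : mu K = mk%:E by rewrite fineK.
have k4 : 0 < kappa ^+ 4 by rewrite exprn_gt0.
have k2 : 0 < kappa ^+ 2 by rewrite exprn_gt0.
(* With this bound for the L^p mean, the right side of the Poincare inequality is
   [3 * r / 32 / kappa ^+ 4], half of the lower bound for the oscillation. *)
pose beta := 3 / (64 * C * kappa ^+ 4).
have beta0 : 0 < beta by rewrite divr_gt0 // !mulr_gt0.
pose F := (4 : R) `^ (p - 1).
have F0 : 0 < F by rewrite powR_gt0.
pose theta := beta `^ p / F.
have theta0 : 0 < theta by rewrite divr_gt0 // powR_gt0.
(* The mean of the gradient may reach [theta]: one half is left to the variation of [D] on the ball,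
   the other to [H], whose mean [good_ball] multiplies by [2 * kappa ^+ 2]. *)
pose a := theta / (4 * kappa ^+ 2).
have a0 : 0 < a by rewrite divr_gt0 // mulr_gt0.
pose d1 := a * mk.
have d10 : 0 < d1 by rewrite mulr_gt0.
have [|s0 s00 hU] := @measure_nbhd2 _ mu K (mk + d1 / 8)%:E cK fin.
  by rewrite muKE lte_fin; lra.
pose U := nbhd2 K s0.
have mU : measurable U by exact: nbhd2_measurable.
have mUK : measurable (U `\` K) by exact: measurableD.
have UK : (mu (U `\` K) <= (d1 / 8)%:E)%E.
  have e : mu U = (mu K + mu (U `\` K))%E.
    rewrite -measureU //; last by rewrite setDIK.
    by rewrite setDUK //; exact: sub_nbhd2.
  move: hU; rewrite -/U e muKE EFinD => /ltW; by rewrite leeD2lE.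
(* The budget [d1] for the integral of [H] is halved: on [K], [eta * mk] and [delta / eta] are each
   [d1 / 4]; off [K], [H] equals 4 on a set of measure at most [d1 / 8]. *)
pose eta := a / 4; have eta0 : 0 < eta by rewrite /eta; lra.
pose delta := d1 * a / 16; have delta0 : 0 < delta by rewrite /delta divr_gt0 // mulr_gt0.
have [w [D [aD near]]] := near_minimal mK Kfin (fun e => thin_admissible ti tK (e := e)) delta0.
have [L L0 lD] := adm_dlip aD.
(* [r] depends on [D] alone, so that the closeness [r / 16] can be prescribed for the second
   pair. *)
pose r := Num.min (theta / (2 * (L + 1) * Lam)) (s0 / Lam).
have L1 : 0 < L + 1 by lra.
have r0 : 0 < r.
  rewrite lt_min; apply/andP; split; apply: divr_gt0 => //.
  by apply: mulr_gt0 => //; exact: mulr_gt0.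
have [r1 r2] : L * (Lam * r) <= theta / 2 /\ Lam * r <= s0.
  have h1 : r <= theta / (2 * (L + 1) * Lam) by rewrite ge_min lexx.
  have h2 : r <= s0 / Lam by rewrite ge_min lexx orbT.
  split; last by rewrite mulrC -ler_pdivlMr.
  move: h1; rewrite ler_pdivlMr ?mulr_gt0 // => h1.
  have : 0 <= Lam * r by rewrite mulr_ge0 // ltW.
  by lra.
have Lr0 : 0 < Lam * r by rewrite mulr_gt0.
have r16 : 0 < r / 16 by lra.
have [w1 [D1 [aD1 hE]]] := near _ r16.
have mD := adm_measurable aD; have mD1 := adm_measurable aD1.
pose Hr z := `|D1 z - D z| * \1_K z + 4 * \1_(U `\` K) z : R.
pose H z := (Hr z)%:E : \bar R.
have H0 z : (0 <= H z)%E by rewrite lee_fin addr_ge0 // mulr_ge0 // indicE.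
have mDD : measurable_fun [set: R * R] (fun z => D1 z - D z) by exact: measurable_funB.
have mHr : measurable_fun [set: R * R] Hr.
  apply: measurable_funD.
    by apply: measurable_funM; [exact: measurableT_comp|exact: measurable_indic].
  by apply: measurable_funM; [exact: measurable_cst|exact: measurable_indic].
have mH : measurable_fun [set: R * R] H by exact/measurable_EFinP.
have HU : (\int[mu]_(z in U) H z <= a%:E * mu K)%E.
  have -> : U = K `|` (U `\` K) by rewrite setDUK //; exact: sub_nbhd2.
  rewrite ge0_integral_setU //; last 2 first.
  - exact: measurable_funTS.
  - by rewrite disj_set2E setDIK.
  have e1 : (\int[mu]_(z in K) H z <= (d1 / 2)%:E)%E.
    have -> : (\int[mu]_(z in K) H z = \int[mu]_(z in K) (`|D1 z - D z|)%:E)%E.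
      apply: eq_integral => z zK; rewrite /H /Hr !indicE zK mulr1.
      by rewrite (memNset (u := z)) ?mulr0 ?addr0 // => -[_]; apply; rewrite inE in zK.
    have b2 z : `|D1 z - D z| <= 2.
      have := adm_bound aD z; have := adm_bound aD1 z.
      by have := ler_normB (D1 z) (D z); lra.
    apply: le_trans (integral_abs_le_energy mK Kfin eta0 mDD b2) _.
    rewrite lee_fin -/mk.
    have : energy mu K (fun z => D1 z - D z) / eta <= delta / eta.
      by apply: ler_wpM2r hE; rewrite invr_ge0 ltW.
    have -> : delta / eta = d1 / 4 by rewrite /delta /eta; field; exact: lt0r_neq0.
    by rewrite /d1 /eta; lra.
  have e2 : (\int[mu]_(z in U `\` K) H z <= (d1 / 2)%:E)%E.
    apply: (@le_trans _ _ (\int[mu]_(z in U `\` K) cst 4%:E z)%E).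
      apply: ge0_le_integral => //; first exact: measurable_funTS.
      move=> z [Uz nKz]; rewrite /H /Hr !indicE memNset // mulr0 add0r lee_fin.
      by rewrite mem_set ?mulr1.
    rewrite integral_cst //; apply: le_trans (lee_wpmul2l _ UK) _ => //.
    by rewrite -EFinM lee_fin; lra.
  apply: le_trans (leeD e1 e2) _; rewrite muKE -EFinM -EFinD lee_fin -/d1.
  by rewrite -splitr.
have KU z : K z -> ball2 z (Lam * r) `<=` U.
  by move=> Kz q zq; exists z => //; exact: lt_le_trans zq r2.
have [z [Kz hz]] := good_ball fin k1 dbl cK K0 mU mH H0 Lr0 (ltW a0) KU HU.
have {}hz : (\int[mu]_(q in ball2 z (Lam * r)) H q <= (theta / 2)%:E * mu (ball2 z (Lam * r)))%E.
  suff <- : 2 * a * kappa ^+ 2 = theta / 2 by [].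
  by rewrite /a; field; exact: lt0r_neq0.
pose c := D z; have c1 : `|c| <= 1 := adm_bound aD z.
have [s s_gt0 ug] := upper_gradient_adm ti aD1 c1.
pose v q := w1 q - c * (tr q).1.
have lv : lip 2 v.
  move=> q q'; have h1 := adm_lip aD1 q q'; have h2 := isometric_fst q q' ti.
  have -> : v q - v q' = w1 q - w1 q' - c * ((tr q).1 - (tr q').1) by rewrite /v; lra.
  apply: le_trans (ler_normB _ _) _; rewrite normrM.
  have : `|c| * `|(tr q).1 - (tr q').1| <= 1 * dist2 q q' by apply: ler_pM.
  by lra.
have li := lip_loc_integrable fin lv.
have := hP z r r0 v _ li ug.
set Bl := ball2 z (Lam * r); set m := mmean _ _ _ => ineq.
have mBl : measurable Bl by exact: ball2_measurable.
have bl0 : 0 < fine (mu Bl) by rewrite fine_gt0 // pos //=; exact: fin.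
have blE : mu Bl = (fine (mu Bl))%:E by rewrite fineK // ball2_fin_num.
have b0 : 0 < fine (mu (ball2 z r)) by rewrite fine_gt0 // pos //=; exact: fin.
have bE : mu (ball2 z r) = (fine (mu (ball2 z r)))%:E by rewrite fineK // ball2_fin_num.
have low : ((3 * r / 16 / kappa ^+ 4)%:E <= (fine (mu (ball2 z r)))^-1%:E *
   \int[mu]_(y in ball2 z r) (`|v y - m|)%:E)%E.
  have vb q : `|v q - ((tr q).2 - c * (tr q).1)| <= r / 16.
    have := adm_near aD1 q.
    by rewrite /v opprB addrA subrK.
  have := @oscillation_lower R mu kappa k1 dbl tr v z c r m ti tt (lip_measurable lv) r0 c1 vb.
  rewrite {1}bE muleC => h.
  by rewrite muleC lee_pdivlMr // muleC.
have up : ((fine (mu Bl))^-1%:E * \int[mu]_(y in Bl) poweR (grad K D1 c s y)%:E p <= (beta `^ p)%:E)%E.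
  rewrite muleC lee_pdivrMr //.
  have [L' _ lD1] := adm_dlip aD1.
  have h0 : 0 <= theta / 2 by rewrite divr_ge0 // ltW.
  have -> : beta `^ p = F * (2 * (theta / 2)).
    by rewrite [2 * _]mulrC divfK // /theta mulrC divfK // lt0r_neq0.
  rewrite -blE /F; apply: (@integral_powR_le Bl (grad K D1 c s) Hr) => //.
  - exact: grad_measurable lD1.
  - by move=> y; exact: grad_ge0.
  - move=> y zy; have Uy := KU z Kz y zy.
    have [g4 gh] := grad_le K L0 lD (adm_bound aD) (adm_bound aD1) s_gt0 zy Uy.
    by split => //; apply: le_trans gh _; rewrite lerD2r.
have rhs : (poweR ((fine (mu Bl))^-1%:E * \int[mu]_(y in Bl) poweR (grad K D1 c s y)%:E p) p^-1 <= beta%:E)%E.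
  have -> : beta%:E = poweR (beta `^ p)%:E p^-1.
    by rewrite poweR_EFin -powRrM mulfV ?gt_eqF // powRr1 // ltW.
  apply: gt0_ler_poweR => //; first by rewrite invr_ge0 ltW.
  - rewrite in_itv /= leey andbT; apply: mule_ge0; first by rewrite lee_fin invr_ge0 ltW.
    by apply: integral_ge0 => y _; rewrite lee_fin powR_ge0.
  - by rewrite in_itv /= leey andbT lee_fin powR_ge0.
have cr0 : 0 < C * (2 * r) by rewrite !mulr_gt0.
have := le_trans low (le_trans ineq (lee_wpmul2l (ltW cr0 : (0 <= (C * (2 * r))%:E)%E) rhs)).
rewrite -EFinM lee_fin.
have -> : C * (2 * r) * beta = 3 * r / 32 / kappa ^+ 4.
  by rewrite /beta; field; rewrite !lt0r_neq0.
rewrite ler_pM2r ?invr_gt0 //; lra.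
Qed.

End Contradiction.

(** * Planar Lebesgue measure as a measure, with bounds on balls *)

Section LebesgueBalls.
Context {R : realType}.
Local Notation leb := (@lebesgue_measure R \x @lebesgue_measure R)%E.

Lemma lebesgue2_set0 : @lebesgue2 R set0 = 0%E.
Proof. exact: (measure0 leb). Qed.

Lemma lebesgue2_ge0 (A : set (R * R)) : (0 <= lebesgue2 A)%E.
Proof. exact: (measure_ge0 leb). Qed.

Lemma lebesgue2_sigma_additive : semi_sigma_additive (@lebesgue2 R).
Proof. exact: (@measure_semi_sigma_additive _ _ _ leb). Qed.

HB.instance Definition _ := isMeasure.Build _ _ _ (@lebesgue2 R)
  lebesgue2_set0 lebesgue2_ge0 lebesgue2_sigma_additive.

Lemma lebesgue2_ball2_fin (z : R * R) (r : R) : (lebesgue2 (ball2 z r) < +oo)%E.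
Proof.
pose s := `|r| + 1; have s0 : 0 <= s by rewrite addr_ge0.
apply: (@le_lt_trans _ _ (lebesgue2 (ball z.1 s `*` ball z.2 s))).
  apply: le_measure; rewrite ?inE.
  - exact: ball2_measurable.
  - by apply: measurableX; exact: measurable_ball.
  - move=> q zq; have h : ball2 z s q.
      by apply: lt_trans zq _; have := ler_norm r; rewrite /s; lra.
    by have [h1 h2] := ball2_ball h.
rewrite /lebesgue2 product_measure1E; [|exact: measurable_ball|exact: measurable_ball].
rewrite [X in (X * _)%E]lebesgue_measure_ball // [X in (_ * X)%E]lebesgue_measure_ball //.
by rewrite -EFinM ltry.
Qed.

(** A square of side [r] fits in the ball; this crude bound on the area suffices for counting. *)
Lemma lebesgue2_ball2_ge (z : R * R) (r : R) : 0 < r -> ((r ^+ 2)%:E <= lebesgue2 (ball2 z r))%E.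
Proof.
move=> r0; have r20 : 0 <= r / 2 by lra.
apply: (@le_trans _ _ (lebesgue2 (ball z.1 (r / 2) `*` ball z.2 (r / 2)))).
  rewrite /lebesgue2 product_measure1E; [|exact: measurable_ball|exact: measurable_ball].
  rewrite [X in (X * _)%E]lebesgue_measure_ball // [X in (_ * X)%E]lebesgue_measure_ball //.
  by rewrite -EFinM lee_fin expr2 mulr2n -splitr.
apply: le_measure; rewrite ?inE.
- by apply: measurableX; exact: measurable_ball.
- exact: ball2_measurable.
- by move=> q [h1 h2]; apply: (ball_ball2 r0); split.
Qed.

End LebesgueBalls.

(** * Reduction to a Lebesgue null compact set of positive measure *)

Unset Implicit Arguments.

Theorem theorem1p4 (R : realType) (mu : {measure set (R * R)%type -> \bar R}) :
  doubling mu ->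
  dense2 (msupport mu) ->
  (exists p : R, 1 <= p /\ poincare mu p) ->
  mu `<< (@lebesgue2 R).
Proof.
move=> [kappa [k1 dbl]] _ [p [p1 hP]] N hN A mA AN.
have pos (z : R * R) (r : R) : 0 < r -> (0 < mu (ball2 z r))%E.
  move=> r0; have r20 : 0 < r / 2 by lra.
  by have [] := dbl z _ r20; have -> : 2 * (r / 2) = r by lra.
have fin (z : R * R) (r : R) : (mu (ball2 z r) < +oo)%E.
  (* Doubling speaks of positive radii only; any ball lies in the one of radius [|r| + 1]. *)
  have s0 : 0 < `|r| + 1 by rewrite ltr_wpDl.
  have [_ [_]] := dbl z _ s0; apply: le_lt_trans.
  apply: (@le_trans _ _ (mu (ball2 z (`|r| + 1)))).
    apply: le_measure; rewrite ?inE; [exact: ball2_measurable|exact: ball2_measurable|].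
    by move=> q zq; apply: lt_trans zq _; have := ler_norm r; lra.
  by apply: lee_pemull => //; rewrite lee_fin.
apply/eqP; rewrite eq_le measure_ge0 andbT leNgt; apply/negP => A0.
have [K [cK KA K0]] := compact_inner fin mA A0.
have mK : measurable K by apply: closed_measurable2; exact: compact_closed hausdorff2 cK.
have nuK : lebesgue2 K = 0%E.
  (* Nullity of [N] is a statement about all its measurable subsets, to which the compact [K]
     belongs. *)
  by apply: hN => //; exact: subset_trans KA AN.
have [K' [tr [cK' K'0 htr tK']]] :=
  @compact_thin_part R mu (@lebesgue2 R) K fin (@lebesgue2_ball2_fin R) (@lebesgue2_ball2_ge R) cK nuK K0.
have dbl' z (r : R) : 0 < r -> (mu (ball2 z (2 * r)) <= kappa%:E * mu (ball2 z r))%E.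
  by move=> r0; have [_ []] := dbl z r r0.
apply: (thin_not_poincare (tr := tr) _ _ pos fin k1 dbl' cK' K'0 tK' p1 hP).
- by case: htr => ->; [move=> ? ?|exact: swap_isometric].
- by case: htr => -> [].
Qed.
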